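(* Suppose that $A\subset\mathbb{R}^n$ is a bounded $1$-unconditional convex domain. Then $$c(A\times_L A^{\circ})\le 4\le \big(n!\,\mathrm{Vol}(A\times_L A^{\circ})\big)^{1/n}$$ for any normalized symplectic capacity $c$ on $\mathbb{R}^{2n}$.
   Context: $\mathbb{R}^{2n}=\mathbb{R}^n_x\times\mathbb{R}^n_y$ carries the standard symplectic structure $\omega_0=\sum_{j=1}^n dx_j\wedge dy_j$. A symplectic capacity on $\mathbb{R}^{2n}$ is a map $c$ assigning to each subset $U\subset\mathbb{R}^{2n}$ a number $c(U)\in[0,\infty]$ such that: (Monotonicity) $c(U)\le c(V)$ for $U\subset V\subset\mathbb{R}^{2n}$; (Conformality) $c(\psi(U))=|\alpha|c(U)$ for every diffeomorphism $\psi$ of $\mathbb{R}^{2n}$ with $\psi^*\omega_0=\alpha\omega_0$, $\alpha\neq 0$; (Nontriviality) $0<c(B^{2n}(1))$ and $c(Z^{2n}(1))<\infty$. Here $B^{2n}(r)=\{z\in\mathbb{R}^{2n}\mid |z|^2<r^2\}$ and $Z^{2n}(R)=B^2(R)\times\mathbb{R}^{2n-2}$, where the factor $B^2(R)$ is the disc in the symplectic $(x_1,y_1)$-plane. It is normalized if $c(B^{2n}(1))=c(Z^{2n}(1))=\pi$. A ''domain'' in a Euclidean space is the closure of a (nonempty) open subset. A centrally symmetric convex domain $K\subset\mathbb{R}^n$ is called $1$-unconditional if there is a basis $\{\eta_1,\dots,\eta_n\}$ of $\mathbb{R}^n$ such that $\big\|\sum_i a_i\eta_i\big\|_K=\big\|\sum_i\varepsilon_i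 a_i\eta_i\big\|_K$ for all scalars $a_i\in\mathbb{R}$ and signs $\varepsilon_i\in\{-1,1\}$, where $\|x\|_K=\min\{t\ge0\mid x\in tK\}$ is the norm on $\mathbb{R}^n$ determined by $K$. The polar of $A\subset\mathbb{R}^n$ is $A^\circ=\{x\in\mathbb{R}^n\mid\langle y,x\rangle\le1\ \forall y\in A\}$. The Lagrangian product is $A\times_L A^\circ=\{(x,y)\in\mathbb{R}^n\times\mathbb{R}^n\mid x\in A,\ y\in A^\circ\}\subset\mathbb{R}^{2n}$. $\mathrm{Vol}$ is Euclidean volume. *)

(* Defs.v *)
From HB Require Import structures.
From mathcomp Require Import all_boot all_order all_algebra.
From mathcomp Require Import all_classical all_reals all_analysis.

Set Implicit Arguments.
Unset Strict Implicit.
Unset Printing Implicit Defensive.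

Import Order.TTheory GRing.Theory Num.Theory.
Import numFieldNormedType.Exports.

Local Open Scope classical_set_scope.
Local Open Scope ring_scope.

(* A point of R^2n = R^n_x x R^n_y is a pair z with x_j = z.1 0 j and
   y_j = z.2 0 j. *)
Notation Rxy R n := ('rV[R]_n * 'rV[R]_n)%type.

Section Smoothness.
Context {R : realType} {V W : normedModType R}.

(* f is k times continuously differentiable: the derivatives along all constant
   directions v are taken k times; in finite dimension this is the usual
   class C^k. *)
Fixpoint Ck (k : nat) (f : V -> W) : Prop :=
  if k is k'.+1 then
    (forall x, differentiable f x) /\
    (forall v, Ck k' (fun x => 'd f x v))
  else continuous f.

Definition smooth (f : V -> W) : Prop := forall k, Ck k f.

End Smoothness.

Definition diffeomorphism {R : realType} {V : normedModType R}
    (psi : V -> V) : Prop :=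
  smooth psi /\
  exists phi : V -> V, [/\ smooth phi, cancel psi phi & cancel phi psi].

Section Capacities.
Context {R : realType} {n : nat}.
Implicit Types (z u v : Rxy R n) (U : set (Rxy R n)).

(* omega_0 = \sum_j dx_j /\ dy_j *)
Definition omega0 u v : R :=
  \sum_j (u.1 0 j * v.2 0 j - v.1 0 j * u.2 0 j).

(* psi^* omega_0 = alpha omega_0 *)
Definition conformally_symplectic (alpha : R) (psi : Rxy R n -> Rxy R n) :=
  forall z u v, omega0 ('d psi z u) ('d psi z v) = alpha * omega0 u v.

(* The norm of the product of matrix spaces is the sup norm, so that
   the library's ball is not the Euclidean one. *)
Definition eball (r : R) : set (Rxy R n) :=
  [set z : Rxy R n | \sum_j (z.1 0 j ^+ 2 + z.2 0 j ^+ 2) < r ^+ 2].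

(* The (x_1, y_1)-coordinates have index 0; for 0 < n there is exactly one
   such i. *)
Definition cylinder (r : R) : set (Rxy R n) :=
  [set z : Rxy R n | forall i : 'I_n, i = 0%N :> nat ->
     z.1 0 i ^+ 2 + z.2 0 i ^+ 2 < r ^+ 2].

Record symplectic_capacity (c : set (Rxy R n) -> \bar R) : Prop := {
  capacity_ge0 : forall U, (0 <= c U)%E ;
  capacity_monotone : forall U V, U `<=` V -> (c U <= c V)%E ;
  capacity_conformal : forall (psi : Rxy R n -> Rxy R n) (alpha : R),
    diffeomorphism psi -> alpha != 0 -> conformally_symplectic alpha psi ->
    forall U, c (psi @` U) = (`|alpha|%:E * c U)%E ;
  capacity_ball_gt0 : (0 < c (eball 1))%E ;
  capacity_cylinder_lty : (c (cylinder 1) < +oo)%E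
}.

Definition normalized (c : set (Rxy R n) -> \bar R) : Prop :=
  c (eball 1) = pi%:E /\ c (cylinder 1) = pi%:E.

End Capacities.

Section ConvexBodies.
Context {R : realType} {n : nat}.
Implicit Types (x y : 'rV[R]_n) (A K : set 'rV[R]_n).

Definition domain A : Prop :=
  exists U : set 'rV[R]_n, [/\ open U, U !=set0 & A = closure U].

Definition centrally_symmetric A : Prop := forall x, A x -> A (- x).

(* The infimum is a minimum when K is a bounded centrally symmetric convex
   domain. *)
Definition norm_of K x : R :=
  inf [set t : R | 0 <= t /\ [set t *: y | y in K] x].

Definition one_unconditional K : Prop :=
  centrally_symmetric K /\
  exists2 eta : n.-tuple 'rV[R]_n, basis_of fullv eta &
    forall a eps : 'I_n -> R, (forall i, eps i = -1 \/ eps i = 1) ->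
      norm_of K (\sum_i a i *: tnth eta i) =
      norm_of K (\sum_i (eps i * a i) *: tnth eta i).

Definition dotv x y : R := \sum_i x 0 i * y 0 i.

Definition polar A : set 'rV[R]_n := [set x | forall y, A y -> dotv y x <= 1].

Definition lagrangian_product A K : set (Rxy R n) :=
  [set z : Rxy R n | A z.1 /\ K z.2].

End ConvexBodies.

Section Volume.
Context {R : realType}.
Local Open Scope ereal_scope.

(* Lebesgue measure on R^n as the n-fold product of lebesgue_measure. *)
Fixpoint lebesgue_tuple (n : nat) :
    set (n.-tuple (measurableTypeR R)) -> \bar R :=
  match n with
  | 0 => \d_([tuple] : 0.-tuple (measurableTypeR R))
  | m.+1 => pushforward (@lebesgue_measure R \x @lebesgue_tuple m)
              (fun p => [tuple of p.1 :: p.2])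
  end.

Definition volume {n : nat} (S : set (Rxy R n)) : \bar R :=
  (@lebesgue_tuple n \x @lebesgue_tuple n)
    [set p | S (\row_i tnth p.1 i, \row_i tnth p.2 i)%R].

End Volume.

(* Main.v *)
Require Import Defs.
From HB Require Import structures.
From mathcomp Require Import all_boot all_order all_algebra.
From mathcomp Require Import all_classical all_reals all_analysis.
From mathcomp Require Import measurable_realfun.
From mathcomp Require Import ring lra.

(** Passing to coordinates a in an unconditional basis, x = a M, is compatible
    with everything in sight: A becomes a closed convex body K of R^n invariant
    under all sign changes, y goes to y M^T, the polar of A goes to the polar
    of K, and (x, y) |-> (x M^-1, y M^T) is linear, symplectic and preserves
    volume.  Both inequalities are then proved for K.

    Upper bound.  Let r be the supremum of |x_1| on K.  Unconditionality puts
    the segment from -x_1 e_1 to x_1 e_1 into K for each x in K, so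
    |y_1| <= 1/r on the polar, and the Lagrangian product lies in the product
    of a rectangle of area 4 with the other coordinates (body_slab).  Up to an
    arbitrarily small error such a rectangle is carried into a round disc of
    area 4 by an area-preserving diffeomorphism of the plane
    (capacity_rectangle): it takes vertical segments to vertical segments, and
    the abscissa is reparametrized so that the area to the left of each of them
    is preserved.  Monotonicity, conformality and normalization on the cylinder
    finish the argument.

    Lower bound.  The claim is |K| |K^o| >= 4^n / n!, proved in two steps.
    First, if U and V are solid (x in U and |x'_i| <= |x_i| for all i imply x'
    in U), then |U| |V| >= 4^n |U.V|, where U.V is the set of the coordinatewise
    products of positive points of U and V (hull_product).  For n = 1 this says
    that a rectangle with sides 2u and 2v has area 4uv, and Tonelli's theorem
    propagates it one coordinate at a time.  Secondly, K.K^o contains the simplex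
    of the positive p with sum at most 1 (factorization): if x maximizes
    prod x_i^(p_i) on K, then the vector y with y_i = p_i / x_i is in the polar,
    by the first-order condition at the maximum.  This is the finite-dimensional
    case of Lozanovskii's factorization.  The simplex has volume 1/n!.

    The invariance of the volume under (x, y) |-> (x M^-1, y M^T) is the linear
    change of variables formula for the iterated Lebesgue measure
    (affine_scaling_unit), used once for M^-1 and once for M^T. *)

Set Implicit Arguments.
Unset Strict Implicit.
Unset Printing Implicit Defensive.

Import Order.TTheory GRing.Theory Num.Theory.
Import numFieldNormedType.Exports.

Local Open Scope classical_set_scope.
Local Open Scope ring_scope.

(** * Functions of class C^k *)

Section SmoothCalculus.
Context {R : realType}.
Implicit Types V W : normedModType R.

Lemma Ck_continuous V W k (f : V -> W) : Ck k f -> continuous f.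
Proof.
by case: k => [//|k] [df _] x; exact: differentiable_continuous.
Qed.

Lemma CkW V W k (f : V -> W) : Ck k.+1 f -> Ck k f.
Proof.
elim: k f => [|k IH] f; first exact: Ck_continuous.
by move=> [df Df]; split=> // v; apply: IH; exact: Df.
Qed.

Lemma Ck_cst V W k (w : W) : Ck k (fun _ : V => w).
Proof.
elim: k w => [|k IH] w /=; first by move=> x; exact: cvg_cst.
split=> [x|v]; first exact: differentiable_cst.
have -> : (fun x => 'd (fun _ : V => w) x v) = fun=> 0; last exact: IH.
by apply/funext => x; rewrite diff_cst.
Qed.

Lemma Ck_linear V W k (L : {linear V -> W}) : continuous L -> Ck k L.
Proof.
move=> cL; case: k => [//|k]; split=> [x|v]; first exact: linear_differentiable.
have -> : (fun x => 'd L x v) = fun=> L v; last exact: Ck_cst.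
by apply/funext => x; rewrite diff_lin.
Qed.

Lemma CkD V W k (f g : V -> W) : Ck k f -> Ck k g -> Ck k (fun x => f x + g x).
Proof.
elim: k f g => [|k IH] f g /=; first by move=> cf cg x; apply: cvgD; [exact: cf|exact: cg].
move=> [df Df] [dg Dg]; split=> [x|v]; first exact: differentiableD.
rewrite (_ : (fun x => _) = (fun x => 'd f x v + 'd g x v)); first exact: IH.
by apply/funext => x; rewrite (diffD (df x) (dg x)).
Qed.

(** With [Ck_comp_linear] and the algebra of scalar functions, this is all of the
    chain rule that is used: the maps built below are linear apart from scalar
    functions of one coordinate. *)
Lemma Ck_linear_comp V W (W' : normedModType R) k (L : {linear W -> W'}) (f : V -> W) :
  continuous L -> Ck k f -> Ck k (L \o f).
Proof.
move=> cL; elim: k f => [|k IH] f /=.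
  by move=> cf x; apply: continuous_comp; [exact: cf|exact: cL].
move=> [df Df]; split=> [x|v].
  by apply: differentiable_comp => //; exact: linear_differentiable.
rewrite (_ : (fun x => _) = (L \o (fun x => 'd f x v))); first exact: IH.
apply/funext => x; rewrite diff_comp//; last exact: linear_differentiable.
by rewrite /= diff_lin.
Qed.

Lemma Ck_comp_linear V W (V' : normedModType R) k (L : {linear V' -> V}) (f : V -> W) :
  continuous L -> Ck k f -> Ck k (f \o L).
Proof.
move=> cL; elim: k f => [|k IH] f /=.
  by move=> cf x; apply: continuous_comp; [exact: cL|exact: cf].
move=> [df Df]; split=> [x|v].
  by apply: differentiable_comp => //; exact: linear_differentiable.
rewrite (_ : (fun x => _) = ((fun x => 'd f x (L v)) \o L)); first exact: IH.
apply/funext => x; rewrite diff_comp//; last exact: linear_differentiable.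
by rewrite /= diff_lin.
Qed.

Lemma CkM V k (f g : V -> R^o) : Ck k f -> Ck k g ->
  Ck k (fun x => f x * g x : R^o).
Proof.
elim: k f g => [|k IH] f g; first by move=> cf cg x; exact: (continuousM (cf x) (cg x)).
move=> /[dup] f1 [df Df] /[dup] g1 [dg Dg]; split=> [x|v].
  by apply: differentiableM; [exact: df|exact: dg].
rewrite (_ : (fun x => _) = (fun x => f x * 'd g x v + g x * 'd f x v : R^o)).
  apply: (@CkD V R^o); first exact: (IH f (fun x => 'd g x v) (CkW f1) (Dg v)).
  exact: (IH g (fun x => 'd f x v) (CkW g1) (Df v)).
by apply/funext => x; rewrite (diffM (df x) (dg x)).
Qed.

Lemma CkV V k (f : V -> R^o) : (forall x, f x != 0) -> Ck k f ->
  Ck k (fun x => (f x)^-1 : R^o).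
Proof.
move=> f0; elim: k => [|k IH].
  by move=> cf x; exact: (continuousV (f0 x) (cf x)).
move=> /[dup] f1 [df Df]; split=> [x|v].
  by apply: differentiableV; [exact: df|exact: f0].
have fk := IH (CkW f1).
rewrite (_ : (fun x => _) =
  (fun x => (-1) * (((f x)^-1 * (f x)^-1) * 'd f x v) : R^o)).
  have c1 : Ck k (fun _ : V => -1 : R^o) by exact: Ck_cst.
  exact: (CkM c1 (CkM (CkM fk fk) (Df v))).
apply/funext => x; rewrite (diffV (df x) (f0 x)) /=.
by rewrite /GRing.scale/= -exprVn expr2; ring.
Qed.

(** The derivative f' / (2 sqrt f) involves only f' and sqrt f itself, so one
    order of regularity is gained at each step from products and inverses. *)
Lemma Ck_sqrt V k (f : V -> R^o) : (forall x, 0 < f x) -> Ck k f ->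
  Ck k (fun x => Num.sqrt (f x) : R^o).
Proof.
move=> f0; elim: k => [|k IH].
  move=> cf x; apply: (@continuous_comp V R^o R^o f Num.sqrt); first exact: cf.
  exact: sqrt_continuous.
move=> /[dup] f1 [df Df].
have ds x : differentiable (Num.sqrt : R^o -> R^o) (f x).
  by apply/derivable1_diffP; have [] := is_derive1_sqrt (f0 x).
split=> [x|v]; first exact: differentiable_comp.
have fk := IH (CkW f1).
rewrite (_ : (fun x => _) = (fun x => 'd f x v * (2 * Num.sqrt (f x))^-1 : R^o)).
  apply: (CkM (Df v)); apply: CkV; last first.
    have c2 : Ck k (fun _ : V => 2 : R^o) by exact: Ck_cst.
    exact: (CkM c2 fk).
  by move=> x; rewrite mulf_neq0// gt_eqF// sqrtr_gt0.
apply/funext => x; rewrite (@diff_comp _ _ _ _ f (Num.sqrt : R^o -> R^o))//=.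
rewrite diff1E// derive1E.
by have [_ ->] := is_derive1_sqrt (f0 x).
Qed.

End SmoothCalculus.

(** * Diffeomorphisms of the line and the profile of the disc *)

Section Line.
Context {R : realType}.

(** The lower end of the domain of integration moves with x so that one formula
    serves the whole line; additivity of the integral shows that, near a given
    point, it agrees up to a constant with integration from a fixed point. *)
Lemma antiderivative_exists (g : R -> R) : continuous g ->
  exists F : R -> R, F 0 = 0 /\ forall x : R, is_derive x 1 F (g x).
Proof.
move=> cg; pose mu := @lebesgue_measure R.
have ig (a b : R) : mu.-integrable `[a, b] (EFin \o g).
  apply: continuous_compact_integrable; first exact: segment_compact.
  exact: continuous_subspaceT.
pose I (a x : R) : R := (\int[mu]_(t in `[a, x]) g t)%R.
have Isplit a b x : a <= b -> b <= x -> I a x = I a b + I b x.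
  move=> ab bx.
  have := @Rintegral_itvB R g (BLeft a) (BRight x) b (ig _ _).
  rewrite !bnd_simp => /(_ ab bx) /eqP; rewrite subr_eq /I => /eqP ->.
  rewrite addrC; congr +%R; rewrite Rintegral_itv_obnd_cbnd//.
  by apply: (integrableS _ _ _ (ig b x)) => //; exact: subset_itv_oc_cc.
pose F (x : R) : R := I (- (`|x| + 1)) x - I (- (`|x| + 1)) 0.
exists F; split; first by rewrite /F subrr.
move=> x; (* One more than the base point at x, so that M is a base point below that of
   every y at distance at most 1 from x. *)
pose M := - (`|x| + 2).
have M0 : M < 0 by rewrite oppr_lt0 ltr_wpDl.
have Mx : M < x by rewrite ltrNl (le_lt_trans (ler_norm _))// normrN ltrDl.
apply: (@near_eq_is_derive _ _ _ (fun y => I M y - I M 0)).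
  near=> y.
  have yx : `|y| <= `|x| + 1.
    rewrite -[y](subrK x) (le_trans (ler_normD _ _))// addrC lerD2l.
    rewrite -normrN opprB; near: y.
    by apply: (@cvgr_dist_le _ _ _ _ _ id x) => //; exact: cvg_id.
  have My : M <= - (`|y| + 1) by rewrite lerN2; lra.
  have yy : - (`|y| + 1) <= y.
    by rewrite lerNl (le_trans (ler_norm _))// normrN lerDl.
  have y0 : - (`|y| + 1) <= 0 by rewrite oppr_le0 addr_ge0.
  by rewrite (Isplit _ _ _ My yy) (Isplit _ _ _ My y0) /F; ring.
have xx1 : x < x + 1 by rewrite ltrDl.
have [dI I'] := continuous_FTC1_closed xx1 (ig M _) Mx (cg x).
rewrite -I' derive1E -[X in is_derive _ _ _ X]subr0.
apply: is_deriveB; exact: derivableP.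
Unshelve. all: by end_near. Qed.

(** A derivative bounded below by m > 0 makes the primitive F strictly increasing
    and of unbounded range, hence bijective. *)
Lemma line_diffeo (m : R) (G : R -> R) : 0 < m -> (forall x, m <= G x) ->
  continuous G ->
  exists F f : R -> R, [/\ F 0 = 0, forall x : R, is_derive x 1 F (G x),
    forall x : R, is_derive x 1 f (G (f x))^-1, cancel F f & cancel f F].
Proof.
move=> m0 mG cG; have [F [F0 dF]] := antiderivative_exists cG.
have cF : continuous F.
  by move=> x; apply/differentiable_continuous/derivable1_diffP; case: (dF x).
have Fm x y : x <= y -> m * (y - x) <= F y - F x.
  move=> xy; have [|z _ ->] := MVT_segment xy (fun z _ => dF z).
    exact: continuous_subspaceT.
  by rewrite ler_wpM2r// subr_ge0.
have surF v : exists x, F x = v.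
  pose M := `|v| / m.
  have M0 : 0 <= M by rewrite divr_ge0// ltW.
  have := Fm 0 M M0; have := Fm (- M) 0; rewrite oppr_le0 => /(_ M0).
  rewrite F0 !subr0 sub0r opprK sub0r mulrC divfK ?gt_eqF// => FN FP.
  have [|||c _ <-] := @IVT R F (- M) M v; last by exists c.
  - by rewrite (le_trans _ M0)// oppr_le0.
  - exact: continuous_subspaceT.
  - rewrite ge_min le_max; apply/andP; split; apply/orP; [left|right].
      by rewrite (le_trans _ (lerNnormlW (lexx _)))// lerNr.
    by rewrite (le_trans (ler_norm _)).
pose f v := projT1 (cid (surF v)).
have fK : cancel f F by move=> v; rewrite /f; case: cid.
have Fi : injective F.
  move=> x y; wlog xy : x y / x <= y.
    by move=> H; have [/H//|/ltW /H h /esym/h] := leP x y.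
  move=> Fxy; apply/eqP; rewrite eq_le xy/= -subr_le0.
  by have := Fm _ _ xy; rewrite Fxy subrr pmulr_rle0.
have FK : cancel F f by move=> x; apply: Fi; rewrite fK.
exists F, f; split => // v.
rewrite -{1}[v]fK; apply: (is_derive_inverse _ _ (dF (f v))).
- by near=> x; exact: FK.
- by near=> x; exact: cF.
- by rewrite gt_eqF// (lt_le_trans m0).
Unshelve. all: by end_near. Qed.

Lemma Ck_primitive k (F G : R -> R) : (forall x : R, is_derive x 1 F (G x)) ->
  Ck k (G : R^o -> R^o) -> Ck k (F : R^o -> R^o).
Proof.
move=> dF CG; apply: CkW; split=> [x|v].
  by apply/derivable1_diffP; case: (dF x).
rewrite (_ : (fun x => _) = (fun x => v * G x : R^o)).
  have c1 : Ck k (fun _ : R^o => v : R^o) by exact: Ck_cst.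
  exact: (CkM c1 CG).
apply/funext => x; have [Dx Ex] := dF x.
rewrite deriv1E//= derive1E; first by rewrite Ex.
Qed.

End Line.

Section Profile.
Context {R : realType}.
Variable d : R.
Hypothesis d0 : 0 < d.

(** A smooth positive approximation, from above, of the half-height sqrt(1 - u^2)
    of the unit disc over the abscissa u; it is ((1 - u^2)^2 + d^2)^(1/4), where
    d^2 removes the singularities at u = 1 and u = -1. *)
Definition profile (u : R) : R := Num.sqrt (Num.sqrt ((1 - u ^+ 2) ^+ 2 + d ^+ 2)).

Lemma profile_arg_gt0 u : 0 < (1 - u ^+ 2) ^+ 2 + d ^+ 2.
Proof. by rewrite ltr_wpDl ?sqr_ge0// exprn_gt0. Qed.

Lemma Ck_profile (V : normedModType R) k (h : V -> R^o) :
  Ck k h -> Ck k (fun x => profile (h x) : R^o).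
Proof.
move=> Ch; apply: Ck_sqrt => [x|]; first by rewrite sqrtr_gt0 profile_arg_gt0.
apply: Ck_sqrt => [x|]; first exact: profile_arg_gt0.
have Cc (c : R) : Ck k (fun _ : V => c : R^o) by exact: Ck_cst.
have C1 : Ck k (fun x => 1 - h x ^+ 2 : R^o).
  rewrite (_ : (fun x => _) = (fun x => 1 + (-1) * (h x * h x) : R^o)).
    by apply: (@CkD _ V R^o) (Cc 1) (CkM (Cc (-1)) (CkM Ch Ch)).
  by apply/funext => x; rewrite expr2; ring.
by apply: (@CkD _ V R^o) (CkM C1 C1) (Cc _).
Qed.

Lemma profile_ge u : Num.sqrt d <= profile u.
Proof.
apply: ler_wsqrtr; rewrite -{1}(ger0_norm (ltW d0)) -sqrtr_sqr; apply: ler_wsqrtr.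
by rewrite lerDr sqr_ge0.
Qed.

Lemma sqr_profile u :
  profile u ^+ 2 = Num.sqrt ((1 - u ^+ 2) ^+ 2 + d ^+ 2).
Proof. by rewrite sqr_sqrtr// sqrtr_ge0. Qed.

Lemma profile_lower u v : u ^+ 2 + v ^+ 2 = 1 -> v <= profile u.
Proof.
move=> uv; rewrite (le_trans (ler_norm v))// -sqrtr_sqr; apply: ler_wsqrtr.
have -> : v ^+ 2 = 1 - u ^+ 2 by rewrite -uv; ring.
rewrite (le_trans (ler_norm _))// -sqrtr_sqr; apply: ler_wsqrtr.
by rewrite lerDl sqr_ge0.
Qed.

Lemma profile_upper u : `|u| <= 1 -> u ^+ 2 + profile u ^+ 2 <= 1 + d.
Proof.
move=> u1; rewrite sqr_profile.
have u2 : 0 <= 1 - u ^+ 2.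
  by rewrite subr_ge0 -[u ^+ 2]ger0_norm ?sqr_ge0// normrX expr_le1.
rewrite -lerBrDl (_ : 1 + d - _ = 1 - u ^+ 2 + d); last by ring.
have ud : 0 <= 1 - u ^+ 2 + d by rewrite addr_ge0// ltW.
rewrite -[leRHS](ger0_norm ud) -sqrtr_sqr; apply: ler_wsqrtr.
have := ltW d0; nra.
Qed.

End Profile.

Section Squeeze.
Context {R : realType}.

(** Since the profile dominates the half-height of the unit disc, its primitive
    grows by at least a quarter of the area of the disc on each side of 0.  The
    comparison is made after the substitution u = sin t, under which the area
    of the disc has the elementary primitive (t + sin t cos t) / 2. *)
Lemma profile_area (d s : R) (F : R -> R) : 0 < d -> 0 < s ->
  (forall x : R, is_derive x 1 F (profile d (s * x))) ->
  pi / 4 <= s * (F s^-1 - F 0) /\ pi / 4 <= s * (F 0 - F (- s^-1)).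
Proof.
move=> d0 s0 dF.
(* H' t = cos t (profile (sin t) - cos t) is nonnegative where cos t is. *)
pose H (t : R) : R := s * F (sin t / s) - (t + sin t * cos t) / 2.
have dH (t : R) : is_derive t 1 H (cos t * (profile d (sin t) - cos t)).
  have dsin : is_derive t 1 (fun t : R => sin t / s) (cos t / s).
    have h := is_deriveM (is_derive_sin t) (is_derive_cst (s^-1 : R^o) t 1).
    by apply: (is_derive_eq h); rewrite scaler0 add0r /GRing.scale/= mulrC.
  have dFs : is_derive t 1 (fun t : R => F (sin t / s))
      (cos t / s * profile d (sin t)).
    have h := @is_derive1_comp _ F (fun t => sin t / s) t _ _ (dF (sin t / s)) dsin.
    by apply: (is_derive_eq h); rewrite [RHS]mulrC (mulrC s) divfK ?gt_eqF.
  have := is_deriveB (is_deriveZ s dFs) (is_deriveZ (2^-1 : R)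
    (is_deriveD (is_derive_id t 1) (is_deriveM (is_derive_sin t) (is_derive_cos t)))).
  rewrite /GRing.scale/= => dH.
  have -> : H = (s \*: (fun t0 => F (sin t0 / s)) - 2^-1 \*: (id + sin * cos)).
    by apply/funext => x; rewrite /H [in LHS](mulrC _ 2^-1).
  apply: is_derive_eq dH _.
  have := sin2cos2 t => {}E; have s2 : sin t * - sin t = cos t ^+ 2 - 1 by rewrite mulrN -expr2 E; ring.
  rewrite s2; field; exact: lt0r_neq0.
have cH : continuous H.
  by move=> x; apply/differentiable_continuous/derivable1_diffP; case: (dH x).
have mono a b : - (pi / 2) <= a -> a <= b -> b <= pi / 2 -> H a <= H b.
  move=> pa ab bp; have [|c cab Hab] := MVT_segment ab (fun z _ => dH z).
    exact: continuous_subspaceT.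
  rewrite -subr_ge0 Hab mulr_ge0// ?subr_ge0// mulr_ge0//.
    move: cab; rewrite in_itv/= => /andP[ac cb].
    by apply: cos_ge0_pihalf; rewrite (le_trans pa ac) (le_trans cb bp).
  by rewrite subr_ge0; apply: profile_lower; rewrite addrC cos2Dsin2.
have pi0 : 0 <= pi / 2 :> R by rewrite divr_ge0// pi_ge0.
have H0 : H 0 = s * F 0 by rewrite /H sin0 mul0r; ring.
have Hp : H (pi / 2) = s * F s^-1 - pi / 4.
  by rewrite /H sin_pihalf cos_pihalf mul1r; field.
have Hn : H (- (pi / 2)) = s * F (- s^-1) + pi / 4.
  by rewrite /H sinN cosN sin_pihalf cos_pihalf mulN1r; field.
split; rewrite mulrBr.
  have := mono 0 (pi / 2); rewrite oppr_le0 H0 Hp => /(_ pi0 pi0 (lexx _)); lra.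
have := mono (- (pi / 2)) 0; rewrite oppr_le0 H0 Hn => /(_ (lexx _) pi0 pi0); lra.
Qed.

(** The one-variable data of the planar map (x, y) |-> (f x, y G (f x)): as
    f' = 1 / (G o f), this map preserves area, and it sends a rectangle of area 4
    into a disc of area less than 4 + e.  A disc of radius 1 has area pi, so all
    lengths are scaled by s = sqrt (pi / 4). *)
Lemma squeezing_profile (a e : R) : 0 < a -> 0 < e ->
  exists F f G : R -> R,
  [/\ forall x, 0 < G x, cancel F f & cancel f F] /\
  [/\ forall k, Ck k (F : R^o -> R^o), forall k, Ck k (f : R^o -> R^o),
      forall k, Ck k (G : R^o -> R^o) & forall k, Ck k (G \o f : R^o -> R^o)] /\
  [/\ forall x : R, is_derive x 1 F (G x),
      forall x : R, is_derive x 1 f (G (f x))^-1 &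
      forall x y, `|x| <= a -> `|y| <= a^-1 ->
        f x ^+ 2 + (y * G (f x)) ^+ 2 < (4 + e) / pi].
Proof.
move=> a0 e0; pose d := e / 8; have d0 : 0 < d by rewrite divr_gt0.
have pi0 : 0 < pi :> R := pi_gt0 R.
pose s : R := Num.sqrt (pi / 4).
have s0 : 0 < s by rewrite sqrtr_gt0 divr_gt0.
have s2 : s ^+ 2 = pi / 4 by rewrite sqr_sqrtr// ltW// divr_gt0.
have as0 : 0 < a / s by rewrite divr_gt0.
pose G (w : R) := a / s * profile d (s * w).
have sd : 0 < Num.sqrt d by rewrite sqrtr_gt0.
have CG (V : normedModType R) k (h : V -> R^o) :
    Ck k h -> Ck k (fun x => G (h x) : R^o).
  move=> Ch; have Cc (c : R) : Ck k (fun _ : V => c : R^o) by exact: Ck_cst.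
  exact: (CkM (Cc (a / s)) (Ck_profile d0 (CkM (Cc s) Ch))).
have Cid k : Ck k (id : R^o -> R^o) by apply: (@Ck_linear R R^o R^o k idfun) => x; exact: cvg_id.
have mG x : a / s * Num.sqrt d <= G x.
  by rewrite ler_wpM2l ?(ltW as0)//; exact: profile_ge.
have G0 x : 0 < G x by rewrite (lt_le_trans _ (mG x))// mulr_gt0.
have CGk k : Ck k (G : R^o -> R^o) := CG R^o k id (Cid k).
have [||F [f [F0 dF df FK fK]]] := @line_diffeo R _ G _ mG.
- by rewrite mulr_gt0.
- exact: (CGk 0%N).
have Cf k : Ck k (f : R^o -> R^o).
  elim: k => [|k IH].
  - move=> x; apply/differentiable_continuous/derivable1_diffP.
    by case: (df x).
  - split=> [x|v]; first by apply/derivable1_diffP; case: (df x).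
    rewrite (_ : (fun x => _) = (fun x => v * (G (f x))^-1 : R^o)).
      have c1 : Ck k (fun _ : R^o => v : R^o) by exact: Ck_cst.
      apply: (CkM c1); apply: CkV; first by move=> x; rewrite gt_eqF.
      exact: (CG R^o k f IH).
    apply/funext => x; have [Dx Ex] := df x.
    by rewrite deriv1E//= derive1E Ex.
exists F, f, G; split=> //; split; [split=> // k|split=> // x y xa ya].
- exact: (Ck_primitive dF).
- exact: (CG R^o k f (Cf k)).
have cF : continuous F.
  by move=> z; apply/differentiable_continuous/derivable1_diffP; case: (dF z).
have incF u v : u < v -> F u < F v.
  move=> uv; have [z _ Fuv] := MVT uv (fun z _ => dF z) (continuous_subspaceT cF).
  by rewrite -subr_gt0 Fuv mulr_gt0// subr_gt0.
have [Fp Fn] : a <= F s^-1 /\ F (- s^-1) <= - a.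
  have dFs (z : R) : is_derive z 1 (s / a \*: F) (profile d (s * z)).
    apply: (is_derive_eq (is_deriveZ (s / a) (dF z))).
    by rewrite /GRing.scale/= /G; field; rewrite !gt_eqF.
  have [] := profile_area d0 s0 dFs.
  rewrite /= F0 scaler0 subr0 sub0r -s2 mulrN /GRing.scale/=.
  rewrite (_ : s * _ = s ^+ 2 * (F s^-1 / a)); last by field; rewrite gt_eqF.
  rewrite (_ : - (s * _) = s ^+ 2 * (- F (- s^-1) / a)); last by field; rewrite gt_eqF.
  rewrite !ler_pMr ?exprn_gt0// !ler_pdivlMr// !mul1r => -> ?.
  by split=> //; rewrite lerNr.
have sf : `|s * f x| <= 1.
  rewrite normrM gtr0_norm// mulrC -ler_pdivlMr// div1r.
  move: xa; rewrite !ler_norml => /andP[xl xr]; apply/andP; split; rewrite leNgt.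
    by apply/negP => /incF; rewrite fK ltNge => /negP; apply; exact: le_trans Fn xl.
  by apply/negP => /incF; rewrite fK ltNge => /negP; apply; exact: le_trans xr Fp.
have := profile_upper d0 sf.
set p := profile d _ => up.
have y2 : (y * a) ^+ 2 <= 1.
  rewrite -[_ ^+ 2]ger0_norm ?sqr_ge0// normrX expr_le1// normrM (gtr0_norm a0).
  by rewrite -ler_pdivlMr// div1r.
have -> : f x ^+ 2 + (y * G (f x)) ^+ 2 =
    ((s * f x) ^+ 2 + (y * a) ^+ 2 * p ^+ 2) / s ^+ 2.
  by rewrite /G -/p; field; rewrite gt_eqF.
have piE (q z : R) : 0 < q -> z / (q / 4) = 4 * z / q.
  by move=> q0; field; rewrite gt_eqF.
rewrite s2 piE//.
rewrite ltr_pM2r ?invr_gt0//.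
have : (y * a) ^+ 2 * p ^+ 2 <= p ^+ 2 by rewrite ler_piMl ?sqr_ge0.
have : d = e / 8 by [].
lra.
Qed.

End Squeeze.

(** * Linear and planar symplectic maps *)

Lemma sum_continuous_at (R : realType) (V W : normedModType R) (I : Type)
    (r : seq I) (f : I -> V -> W) (x : V) :
  (forall i, {for x, continuous (f i)}) ->
  {for x, continuous (fun x => \sum_(i <- r) f i x)}.
Proof.
move=> cf; elim: r => [|i r IH].
  rewrite (_ : (fun x => _) = fun=> 0); first exact: cvg_cst.
  by apply/funext => y; rewrite big_nil.
rewrite (_ : (fun x => _) = (fun x => f i x + \sum_(j <- r) f j x)).
  by apply: cvgD; [exact: cf|exact: IH].
by apply/funext => y; rewrite big_cons.
Qed.

Section LinearMaps.
Context {R : realType} {n : nat}.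

Lemma mulmxr_continuous (B : 'M[R]_n) : continuous (fun x : 'rV[R]_n => x *m B).
Proof.
rewrite (_ : (fun x => _) = (fun x : 'rV[R]_n => \sum_i x 0 i *: row i B)); last first.
  by apply/funext => x; exact: mulmx_sum_row.
move=> x; apply: sum_continuous_at => i.
by apply: continuousZr_tmp; exact: coord_continuous.
Qed.

Definition dualmap (B C : 'M[R]_n) (z : Rxy R n) : Rxy R n := (z.1 *m B, z.2 *m C).

Lemma dualmap_is_linear B C : linear (dualmap B C).
Proof. by move=> k u v; rewrite /dualmap /= !mulmxDl -!scalemxAl. Qed.
HB.instance Definition _ B C := GRing.isLinear.Build R (Rxy R n) (Rxy R n) _
  (dualmap B C) (dualmap_is_linear B C).

Lemma dualmap_continuous B C : continuous (dualmap B C).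
Proof.
move=> z; apply: (@cvg_pair _ _ _ _ (nbhs (z.1 *m B)) (nbhs (z.2 *m C))).
  apply: (@continuous_comp _ _ _ fst (fun x : 'rV[R]_n => x *m B)).
    exact: cvg_fst.
  exact: mulmxr_continuous.
apply: (@continuous_comp _ _ _ snd (fun x : 'rV[R]_n => x *m C)).
  exact: cvg_snd.
exact: mulmxr_continuous.
Qed.

Lemma dualmap_smooth B C : smooth (dualmap B C).
Proof. by move=> k; apply: Ck_linear; exact: dualmap_continuous. Qed.

Lemma dualmapM B C B' C' z :
  dualmap B C (dualmap B' C' z) = dualmap (B' *m B) (C' *m C) z.
Proof. by rewrite /dualmap /= !mulmxA. Qed.

Lemma dualmap1 z : dualmap 1%:M 1%:M z = z.
Proof. by rewrite /dualmap !mulmx1; case: z. Qed.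

Lemma dualmap_diffeo B C : B \in unitmx -> C \in unitmx ->
  diffeomorphism (dualmap B C).
Proof.
move=> uB uC; split; first exact: dualmap_smooth.
exists (dualmap (invmx B) (invmx C)); split; first exact: dualmap_smooth.
  by move=> z; rewrite dualmapM !mulmxV// dualmap1.
by move=> z; rewrite dualmapM !mulVmx// dualmap1.
Qed.

Lemma omega0E (u v : Rxy R n) :
  omega0 u v = (u.1 *m v.2^T - v.1 *m u.2^T) 0 0.
Proof.
rewrite !mxE /omega0 sumrB; congr (_ - _); apply: eq_bigr => j _; by rewrite mxE.
Qed.

(** omega_0 pairs positions with momenta, so acting by B on the former and by
    C on the latter multiplies it by alpha when B C^T = alpha. *)
Lemma dualmap_conformal B C alpha : B *m C^T = alpha%:M ->
  conformally_symplectic alpha (dualmap B C).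
Proof.
move=> BC z u v; rewrite !diff_lin; last exact: dualmap_continuous.
rewrite !omega0E /= !trmx_mul -!mulmxA.
rewrite !(mulmxA B) BC !mul_scalar_mx -!scalemxAr.
by rewrite -scalerBr mxE.
Qed.

End LinearMaps.

Section DiffAt.
Context {R : realType}.

Lemma diffD_at (V W : normedModType R) (f g : V -> W) (x u : V) :
  differentiable f x -> differentiable g x ->
  'd (fun z => f z + g z) x u = 'd f x u + 'd g x u.
Proof. by move=> df dg; rewrite (diffD df dg). Qed.

Lemma diffB_at (V W : normedModType R) (f g : V -> W) (x u : V) :
  differentiable f x -> differentiable g x ->
  'd (fun z => f z - g z) x u = 'd f x u - 'd g x u.
Proof. by move=> df dg; rewrite (diffB df dg). Qed.

Lemma diffM_at (V : normedModType R) (f g : V -> R^o) (x u : V) :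
  differentiable f x -> differentiable g x ->
  'd (fun z => f z * g z : R^o) x u = f x * 'd g x u + g x * 'd f x u.
Proof. by move=> df dg; rewrite (diffM df dg). Qed.

Lemma diff_comp_at (U V W : normedModType R) (f : U -> V) (g : V -> W) (x u : U) :
  differentiable f x -> differentiable g (f x) ->
  'd (fun z => g (f z)) x u = 'd g (f x) ('d f x u).
Proof. by move=> df dg; rewrite (diff_comp df dg). Qed.

End DiffAt.

Section Stretch.
Context {R : realType} {n : nat} (i0 : 'I_n).
Implicit Types (z u v : Rxy R n) (a b : R -> R).

Definition xcoord (z : Rxy R n) : R^o := z.1 0 i0.
Definition ycoord (z : Rxy R n) : R^o := z.2 0 i0.
Definition xline (t : R^o) : Rxy R n := (t *: delta_mx 0 i0, 0).
Definition yline (t : R^o) : Rxy R n := (0, t *: delta_mx 0 i0).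

Lemma xcoord_is_linear : linear xcoord.
Proof. by move=> k u v; rewrite /xcoord /= !mxE. Qed.
HB.instance Definition _ := GRing.isLinear.Build R (Rxy R n) R^o _
  xcoord xcoord_is_linear.
Lemma ycoord_is_linear : linear ycoord.
Proof. by move=> k u v; rewrite /ycoord /= !mxE. Qed.
HB.instance Definition _ := GRing.isLinear.Build R (Rxy R n) R^o _
  ycoord ycoord_is_linear.
Lemma xline_is_linear : linear xline.
Proof.
move=> k u v; rewrite /xline; congr pair; rewrite /= ?scaler0 ?addr0//.
by rewrite scalerDl scalerA.
Qed.
HB.instance Definition _ := GRing.isLinear.Build R R^o (Rxy R n) _
  xline xline_is_linear.
Lemma yline_is_linear : linear yline.
Proof.
move=> k u v; rewrite /yline; congr pair; rewrite /= ?scaler0 ?addr0//.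
by rewrite scalerDl scalerA.
Qed.
HB.instance Definition _ := GRing.isLinear.Build R R^o (Rxy R n) _
  yline yline_is_linear.

Lemma xcoord_continuous : continuous xcoord.
Proof.
move=> z; apply: (@continuous_comp _ _ _ fst (fun x : 'rV[R]_n => x 0 i0)).
  exact: cvg_fst.
exact: coord_continuous.
Qed.
Lemma ycoord_continuous : continuous ycoord.
Proof.
move=> z; apply: (@continuous_comp _ _ _ snd (fun x : 'rV[R]_n => x 0 i0)).
  exact: cvg_snd.
exact: coord_continuous.
Qed.
Lemma xline_continuous : continuous xline.
Proof.
move=> t; apply: (@cvg_pair _ _ _ _ (nbhs (t *: delta_mx 0 i0)) (nbhs (0 : 'rV[R]_n))).
  exact: scalel_continuous.
exact: cvg_cst.
Qed.
Lemma yline_continuous : continuous yline.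
Proof.
move=> t; apply: (@cvg_pair _ _ _ _ (nbhs (0 : 'rV[R]_n)) (nbhs (t *: delta_mx 0 i0))).
  exact: cvg_cst.
exact: scalel_continuous.
Qed.

(** The map (x, y) |-> (a x, y b(x)) in the plane with index i0, the identity in
    the other planes.  Writing it as the identity plus a correction along two
    fixed lines reduces its smoothness to that of scalar functions. *)
Definition stretch a b z : Rxy R n :=
  z + xline (a (xcoord z) - xcoord z) + yline (ycoord z * b (xcoord z) - ycoord z).

Lemma stretch_x a b z : xcoord (stretch a b z) = a (xcoord z).
Proof. by rewrite /stretch /xcoord /= !mxE !eqxx/= mulr1 addr0 addrC subrK. Qed.
Lemma stretch_y a b z : ycoord (stretch a b z) = ycoord z * b (xcoord z).
Proof. by rewrite /stretch /ycoord /= !mxE !eqxx/= mulr1 addr0 addrC subrK. Qed.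

Lemma stretchK a b a' b' : cancel a a' -> (forall x, b x * b' (a x) = 1) ->
  cancel (stretch a b) (stretch a' b').
Proof.
move=> aK bb z; rewrite {1}/stretch stretch_x stretch_y aK -mulrA bb mulr1.
rewrite -(opprB (a _)) -(opprB (_ * b _)) !linearN/=.
by rewrite /stretch (addrAC _ (yline _)) !addrK.
Qed.

Lemma stretch_smooth a b : smooth (a : R^o -> R^o) -> smooth (b : R^o -> R^o) ->
  smooth (stretch a b).
Proof.
move=> Ca Cb k.
have Cx : Ck k xcoord := Ck_linear k xcoord_continuous.
have Cy : Ck k ycoord := Ck_linear k ycoord_continuous.
have Cax : Ck k (a \o xcoord) := Ck_comp_linear xcoord_continuous (Ca k).
have Cbx : Ck k (b \o xcoord) := Ck_comp_linear xcoord_continuous (Cb k).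
have CN (h : Rxy R n -> R^o) : Ck k h -> Ck k (fun z => - h z : R^o).
  move=> Ch; rewrite (_ : (fun z => _) = (fun z => -1 * h z : R^o)).
    have c1 : Ck k (fun _ : Rxy R n => -1 : R^o) by exact: Ck_cst.
    exact: (CkM c1 Ch).
  by apply/funext => z; rewrite mulN1r.
apply: CkD; first apply: CkD.
- by apply: (@Ck_linear _ _ _ k idfun) => z; exact: cvg_id.
- exact: (Ck_linear_comp xline_continuous (CkD Cax (CN _ Cx))).
- exact: (Ck_linear_comp yline_continuous (CkD (CkM Cy Cbx) (CN _ Cy))).
Qed.

(** The differential in the plane i0 is triangular with diagonal entries 1 / b
    and b. *)
Lemma stretch_symplectic a b : (forall x, b x != 0) ->
  (forall x : R, is_derive x 1 a (b x)^-1) -> smooth (b : R^o -> R^o) ->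
  conformally_symplectic 1 (stretch a b).
Proof.
move=> b0 da Cb z.
have dx := linear_differentiable z xcoord_continuous.
have dy := linear_differentiable z ycoord_continuous.
have da' : differentiable (a : R^o -> R^o) (xcoord z).
  by apply/derivable1_diffP; case: (da (xcoord z)).
have db' : differentiable (b : R^o -> R^o) (xcoord z) := (Cb 1%N).1 _.
pose ax z : R^o := a (xcoord z); pose bx z : R^o := b (xcoord z).
have dax : differentiable ax z by exact: differentiable_comp.
have dbx : differentiable bx z by exact: differentiable_comp.
have dybx : differentiable (fun z => ycoord z * bx z : R^o) z.
  exact: differentiableM.
have d1 : differentiable (fun z => ax z - xcoord z : R^o) z.
  exact: differentiableB.
have d2 : differentiable (fun z => ycoord z * bx z - ycoord z : R^o) z.
  exact: differentiableB.
have dlx t := linear_differentiable t xline_continuous.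
have dly t := linear_differentiable t yline_continuous.
have dS u : 'd (stretch a b) z u =
  u + xline (xcoord u * (b (xcoord z))^-1 - xcoord u) +
  yline (ycoord z * ('d b (xcoord z) (xcoord u)) + b (xcoord z) * ycoord u - ycoord u).
  have Ex : 'd xcoord z u = xcoord u by rewrite diff_lin//; exact: xcoord_continuous.
  have Ey : 'd ycoord z u = ycoord u by rewrite diff_lin//; exact: ycoord_continuous.
  have E1 : 'd ax z u = xcoord u * (b (xcoord z))^-1.
    rewrite (diff_comp_at _ dx da') Ex.
    have [Da Ea] := da (xcoord z).
    by rewrite deriv1E//= derive1E Ea.
  have E2 : 'd bx z u = 'd b (xcoord z) (xcoord u).
    by rewrite (diff_comp_at _ dx db') Ex.
  have Did : differentiable (id : Rxy R n -> _) z by exact: ex_diff.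
  pose s1 z : Rxy R n := xline (ax z - xcoord z).
  pose s2 z : Rxy R n := yline (ycoord z * bx z - ycoord z).
  have Ds1 : differentiable s1 z := differentiable_comp d1 (dlx _).
  have Ds2 : differentiable s2 z := differentiable_comp d2 (dly _).
  have s1E : 'd s1 z u = xline ('d ax z u - 'd xcoord z u).
    transitivity ('d xline (ax z - xcoord z) ('d (fun z => ax z - xcoord z : R^o) z u)).
      exact: (diff_comp_at u d1 (dlx _)).
    rewrite diff_lin; last exact: xline_continuous.
    congr xline; exact: diffB_at.
  have s2E : 'd s2 z u = yline (ycoord z * 'd bx z u + bx z * 'd ycoord z u - 'd ycoord z u).
    transitivity ('d yline (ycoord z * bx z - ycoord z)
        ('d (fun z => ycoord z * bx z - ycoord z : R^o) z u)).
      exact: (diff_comp_at u d2 (dly _)).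
    rewrite diff_lin; last exact: yline_continuous.
    congr yline; apply: (etrans (diffB_at u dybx dy)); congr (_ - _).
    exact: diffM_at.
  transitivity ('d (fun z => z + s1 z) z u + 'd s2 z u).
    exact: (diffD_at u (differentiableD Did Ds1) Ds2).
  congr (_ + _); last first.
    apply: (etrans s2E); congr yline.
    exact: (f_equal2 (fun p q : R => ycoord z * p + bx z * q - q) E2 Ey).
  apply: (etrans (diffD_at u Did Ds1)); congr (_ + _).
    by rewrite diff_val.
  by apply: (etrans s1E); congr (xline (_ - _)).
have Db : derivable b (xcoord z) 1 by exact/derivable1_diffP.
have bE w : 'd b (xcoord z) w = w * derive1 b (xcoord z) by rewrite (deriv1E Db).
move: (derive1 b (xcoord z)) bE => B bE.
move=> u v; rewrite mul1r /omega0 (bigD1 i0)//= [RHS](bigD1 i0)//=.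
congr (_ + _).
  rewrite !dS /= !mxE !eqxx/= !mulr1 !addr0 !(addrC _ (_ - _)) !subrK.
  by rewrite !bE /xcoord /ycoord /=; field; exact: b0.
by apply: eq_bigr => j /negPf ji; rewrite !dS /= !mxE ji/= !mulr0 !addr0.
Qed.

End Stretch.

(** * The capacity of a rectangle times a linear space *)

Section Rectangle.
Context {R : realType} {n : nat}.
Variable c : set (Rxy R n) -> \bar R.
Hypothesis cP : symplectic_capacity c.
Hypothesis cN : normalized c.

Lemma capacity_cylinder (rho : R) : 0 < rho ->
  c (cylinder rho) = (rho ^+ 2 * pi)%:E.
Proof.
move=> rho0; have [_ cZ] := cN.
have -> : cylinder rho = dualmap (rho%:M) (rho%:M) @` cylinder 1 :> set (Rxy R n).
  rewrite predeqE => w; split=> [wr|[z z1 <-] i i0].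
    exists (dualmap (rho^-1%:M) (rho^-1%:M) w).
      move=> i i0; rewrite /dualmap /= !mul_mx_scalar !mxE !exprMn -mulrDr.
      rewrite exprVn [ltRHS]expr1n -[ltRHS](@mulVf _ (rho ^+ 2)) ?gt_eqF ?exprn_gt0//.
      by rewrite ltr_pM2l ?invr_gt0 ?exprn_gt0//; exact: wr.
    by rewrite dualmapM -scalar_mxM mulVf ?gt_eqF// dualmap1.
  rewrite /dualmap /= !mul_mx_scalar !mxE !exprMn -mulrDr gtr_pMr ?exprn_gt0//.
  by rewrite -[ltRHS](expr1n _ 2); exact: z1.
have urho : (rho%:M : 'M[R]_n) \in unitmx.
  by rewrite unitmxE det_scalar unitrX// unitfE gt_eqF.
have /(capacity_conformal cP) : diffeomorphism (dualmap (rho%:M : 'M[R]_n) rho%:M).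
  exact: dualmap_diffeo.
move=> /(_ (rho ^+ 2)) ->.
- by rewrite cZ gtr0_norm ?exprn_gt0.
- by rewrite sqrf_eq0 gt_eqF.
- by apply: dualmap_conformal; rewrite tr_scalar_mx -scalar_mxM expr2.
Qed.

(** The rectangle is squeezed into the cylinder of radius rho with
    rho^2 pi = 4 + e, for every e > 0. *)
Lemma capacity_rectangle (i0 : 'I_n) (a : R) : i0 = 0%N :> nat -> 0 < a ->
  (c [set z : Rxy R n | (`|z.1 0 i0| <= a /\ `|z.2 0 i0| <= a^-1)%R] <= 4%:E)%E.
Proof.
move=> i00 a0; set S := [set z | _].
apply/lee_addgt0Pr => e e0; rewrite -EFinD.
have [F [f [G [[G0 FK fK] [[CF Cf CG sb] [dF df fG]]]]]] := squeezing_profile a0 e0.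
have sb' : smooth (fun x => (G x)^-1 : R^o).
  by move=> k; apply: CkV => [x|]; [rewrite gt_eqF|exact: CG].
have Gf0 x : (G \o f) x != 0 by rewrite /= gt_eqF.
have psiD : diffeomorphism (stretch i0 f (G \o f)).
  split; first exact: stretch_smooth.
  exists (stretch i0 F (fun x => (G x)^-1)); split; first exact: stretch_smooth.
    by apply: stretchK => // x /=; rewrite mulfV// gt_eqF.
  by apply: stretchK => // x /=; rewrite FK mulVf// gt_eqF.
have psiS : conformally_symplectic 1 (stretch i0 f (G \o f)).
  exact: stretch_symplectic.
have := capacity_conformal cP psiD (oner_neq0 _) psiS S.
rewrite normr1 mul1e => <-.
pose rho := Num.sqrt ((4 + e) / pi).
have e4 : 0 < (4 + e) / pi by rewrite divr_gt0 ?pi_gt0// addr_gt0.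
have rho2 : rho ^+ 2 = (4 + e) / pi by rewrite sqr_sqrtr// ltW.
rewrite -[4 + e](divfK (_ : pi != 0)) ?gt_eqF ?pi_gt0// -rho2.
rewrite -capacity_cylinder ?sqrtr_gt0//; apply: (capacity_monotone cP).
move=> _ [z [zx zy] <-] i ii0; have -> : i = i0 by apply: val_inj; rewrite /= ii0 i00.
have := fG _ _ zx zy; rewrite -rho2.
have := stretch_x i0 f (G \o f) z; have := stretch_y i0 f (G \o f) z.
by rewrite /xcoord /ycoord => -> ->.
Qed.

End Rectangle.

(** * The iterated Lebesgue measure *)

Section LebesgueTuple.
Context {R : realType}.
Local Notation T := (measurableTypeR R).
Local Notation leb := (@lebesgue_measure R).
Local Notation mu n := (@lebesgue_tuple R n).

Definition tcons n (p : T * n.-tuple T) : n.+1.-tuple T := [tuple of p.1 :: p.2].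
Definition tuncons n (p : n.+1.-tuple T) : T * n.-tuple T :=
  (thead p, [tuple of behead p]).

Lemma tconsK n : cancel (@tcons n) (@tuncons n).
Proof. by move=> [t p]; congr pair; exact: val_inj. Qed.

Lemma measurable_tcons n : measurable_fun setT (@tcons n).
Proof. by apply: measurable_cons; [exact: measurable_fst|exact: measurable_snd]. Qed.

Lemma measurable_tuncons n : measurable_fun setT (@tuncons n).
Proof.
apply/measurable_fun_pairP; split; first exact: measurable_tnth.
exact: measurable_behead.
Qed.

Lemma measurable_preimage_tcons n (S : set (n.+1.-tuple T)) :
  measurable S -> measurable (@tcons n @^-1` S).
Proof. by move=> mS; rewrite -[X in measurable X]setTI; exact: measurable_tcons. Qed.

Section Step.
Variables (n : nat) (m : {sigma_finite_measure set (n.-tuple T) -> \bar R}).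

(** The recursion step of [lebesgue_tuple], for an arbitrary measure in place of
    the n-dimensional one, so that it can be shown to be a sigma-finite measure. *)
Definition tuple_step (S : set (n.+1.-tuple T)) : \bar R :=
  (leb \x m)%E (@tcons n @^-1` S).

Let step0 : tuple_step set0 = 0%E.
Proof. by rewrite /tuple_step preimage_set0 measure0. Qed.

Let step_ge0 S : (0 <= tuple_step S)%E. Proof. exact: measure_ge0. Qed.

Let step_additive : semi_sigma_additive tuple_step.
Proof.
move=> F mF tF mUF; rewrite /tuple_step preimage_bigcup.
apply: measure_semi_sigma_additive => [k||].
- exact: measurable_preimage_tcons.
- apply/trivIsetP => i j _ _ ij; rewrite -preimage_setI.
  by move/trivIsetP : tF => /(_ _ _ _ _ ij) ->//; rewrite preimage_set0.
- by rewrite -preimage_bigcup; exact: measurable_preimage_tcons.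
Qed.

HB.instance Definition _ := isMeasure.Build _ _ _ tuple_step
  step0 step_ge0 step_additive.

Let step_sigma_finite : sigma_finite setT tuple_step.
Proof.
have /sigma_finiteP[F [FT ndF Foo]] := sigma_finiteT leb.
have /sigma_finiteP[G [GT ndG Goo]] := sigma_finiteT m.
exists (fun k => @tuncons n @^-1` (F k `*` G k)).
  rewrite -preimage_bigcup (_ : \bigcup_k _ = setT) ?preimage_setT//.
  rewrite -subTset => -[x y] _.
  have [i _ Fx] : (\bigcup_i F i) x by rewrite -FT.
  have [j _ Gy] : (\bigcup_i G i) y by rewrite -GT.
  exists (maxn i j) => //; split; move: Fx Gy => /= Fx Gy.
    by move: x Fx; apply/subsetPset/ndF/leq_maxl.
  by move: y Gy; apply/subsetPset/ndG/leq_maxr.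
move=> k; have [mF Fk] := Foo k; have [mG Gk] := Goo k; split.
  rewrite -[X in measurable X]setTI; apply: measurable_tuncons => //.
  exact: measurableX.
rewrite /tuple_step -comp_preimage (_ : _ \o _ = id) ?preimage_id.
  by rewrite product_measure1E// lte_mul_pinfty// ge0_fin_numE.
by apply/funext => p /=; rewrite tconsK.
Qed.

HB.instance Definition _ := Measure_isSigmaFinite.Build _ _ _ tuple_step
  step_sigma_finite.

End Step.

(** [lebesgue_tuple] is defined on bare set functions; exhibiting a measure with
    the same values transports the measure axioms to it. *)
Lemma lebesgue_tuple_measure_exists n :
  exists m : {sigma_finite_measure set (n.-tuple T) -> \bar R},
    mu n = m :> (set (n.-tuple T) -> \bar R).
Proof.
elim: n => [|n [m IH]]; first by exists (\d_([tuple] : 0.-tuple T)).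
by exists (tuple_step m); rewrite /= IH.
Qed.

Let tuple_measure n := projT1 (cid (lebesgue_tuple_measure_exists n)).
Let tuple_measureE n : mu n = tuple_measure n :> (set (n.-tuple T) -> \bar R).
Proof. by rewrite /tuple_measure; case: cid. Qed.

Let tuple0 n : mu n set0 = 0%E.
Proof. by rewrite tuple_measureE measure0. Qed.
Let tuple_ge0 n S : (0 <= mu n S)%E.
Proof. by rewrite tuple_measureE. Qed.
Let tuple_additive n : semi_sigma_additive (mu n).
Proof. by rewrite tuple_measureE; exact: measure_semi_sigma_additive. Qed.
Let tuple_sigma_finite n : sigma_finite setT (mu n).
Proof. by rewrite tuple_measureE; exact: sigma_finiteT. Qed.

HB.instance Definition _ n := isMeasure.Build _ _ _ (@lebesgue_tuple R n)
  (@tuple0 n) (@tuple_ge0 n) (@tuple_additive n).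
HB.instance Definition _ n := Measure_isSigmaFinite.Build _ _ _
  (@lebesgue_tuple R n) (@tuple_sigma_finite n).


End LebesgueTuple.

(** * Volume of sets of row vectors *)

(** The integral of a nonnegative function is a supremum over the simple functions
    below it, hence monotone for arbitrary functions; this makes the volumes of
    arbitrary sets comparable. *)
Lemma le_integral_any d (T : measurableType d) (R : realType)
    (m : {measure set T -> \bar R}) (f g : T -> \bar R) :
  (forall x, 0 <= f x)%E -> (forall x, f x <= g x)%E ->
  (\int[m]_x f x <= \int[m]_x g x)%E.
Proof.
move=> f0 fg; have g0 x : (0 <= g x)%E by exact: le_trans (f0 x) (fg x).
rewrite !ge0_integralTE//; apply: le_ereal_sup => _ [h hf <-].
by exists h => // x; exact: le_trans (hf x) (fg x).
Qed.

Lemma product_measure_swap d1 d2 (T1 : measurableType d1)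
    (T2 : measurableType d2) (R : realType)
    (m1 : {sigma_finite_measure set T1 -> \bar R})
    (m2 : {sigma_finite_measure set T2 -> \bar R}) (X : set (T1 * T2)) :
  measurable X -> (m1 \x m2)%E X = (m1 \x^ m2)%E X.
Proof.
by move=> mX; apply: product_measure_unique => //= A B mA mB; rewrite product_measure2E.
Qed.

Section RowVolume.
Context {R : realType}.
Local Notation T := (measurableTypeR R).
Local Notation leb := (@lebesgue_measure R).
Local Notation mu n := (@lebesgue_tuple R n).

(** The product sigma-algebra lives on tuples and linear algebra on row vectors;
    [rvol] and [rmeas] transport volume and measurability to row vectors. *)
Definition rowt n (p : n.-tuple T) : 'rV[R]_n := \row_i tnth p i.
Definition tupr n (x : 'rV[R]_n) : n.-tuple T := [tuple x 0 i | i < n].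
Definition rvol n (S : set 'rV[R]_n) : \bar R := mu n (@rowt n @^-1` S).
Definition rmeas n (S : set 'rV[R]_n) := measurable (@rowt n @^-1` S).

Lemma tuprK n : cancel (@tupr n) (@rowt n).
Proof. by move=> x; apply/rowP => i; rewrite mxE tnth_mktuple. Qed.

Lemma rmeas_preimage m n (f : 'rV[R]_m -> 'rV[R]_n) (S : set 'rV[R]_n) :
  (forall i, measurable_fun setT (fun p : m.-tuple T => f (rowt p) 0 i : T)) ->
  rmeas S -> rmeas (f @^-1` S).
Proof.
move=> mf mS; pose g := @tupr n \o f \o @rowt m.
have mg : measurable_fun setT g.
  apply/measurable_fun_tnthP => i.
  rewrite (_ : _ \o _ = (fun p => f (rowt p) 0 i))//.
  by apply/funext => p; rewrite /= tnth_mktuple.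
rewrite /rmeas (_ : _ @^-1` _ = g @^-1` (@rowt n @^-1` S)).
  by rewrite -[X in measurable X]setTI; exact: mg.
by apply/seteqP; split=> p /=; rewrite tuprK.
Qed.

Lemma measurable_rowt n (i : 'I_n) :
  measurable_fun setT (fun p : n.-tuple T => rowt p 0 i : T).
Proof.
rewrite (_ : (fun p => _) = (fun p => tnth p i)); first exact: measurable_tnth.
by apply/funext => p; rewrite mxE.
Qed.

Lemma rmeas_affine m n (G : 'M[R]_(m, n)) v S :
  rmeas S -> rmeas [set x | S (x *m G + v)].
Proof.
apply: (@rmeas_preimage _ _ (fun x => x *m G + v)) => i.
rewrite (_ : (fun p => _) =
    (fun p => \sum_j rowt p 0 j * G j i + v 0 i)); last first.
  by apply/funext => p; rewrite !mxE.
apply: measurable_funD => //; apply: measurable_sum => j.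
apply: measurable_funM => //; exact: measurable_rowt.
Qed.

Lemma rmeas_coords n (B : 'I_n -> set R) : (forall i, measurable (B i : set T)) ->
  rmeas [set x | forall i, B i (x 0 i)].
Proof.
move=> mB; rewrite /rmeas (_ : _ @^-1` _ =
    \bigcap_(i in [set: 'I_n]) ((fun p => rowt p 0 i) @^-1` B i)).
  apply: fin_bigcap_measurable => // i _.
  by rewrite -[X in measurable X]setTI; exact: measurable_rowt.
by apply/seteqP; split=> p /= h i; [move=> _; exact: h|exact: h].
Qed.

Lemma rmeas_bigcup (I : countType) n (F : I -> set 'rV[R]_n) :
  (forall i, rmeas (F i)) -> rmeas [set x | exists i, F i x].
Proof.
move=> mF; rewrite /rmeas (_ : _ @^-1` _ =
    \bigcup_(i in [set: I]) (@rowt n @^-1` F i)).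
  by apply: countable_bigcupT_measurable => //; exact: countableP.
by apply/seteqP; split=> p /= [i]; [exists i|move=> _; exists i].
Qed.

Lemma rvol_ge0 n (S : set 'rV[R]_n) : (0 <= rvol S)%E.
Proof. exact: measure_ge0. Qed.

Definition row_cons n (t : R) (x : 'rV[R]_n) : 'rV[R]_n.+1 := row_mx (t%:M : 'M[R]_1) x.

Lemma rowt_tcons n t (p : n.-tuple T) : rowt (tcons (t, p)) = row_cons t (rowt p).
Proof.
apply/rowP => i; rewrite mxE /row_cons.
case: (@split_ordP 1 n i) => j ->.
  rewrite (@row_mxEl _ 1 1 n) [j]ord1 mxE eqxx mulr1n.
  by rewrite (_ : @lshift 1 n ord0 = ord0 :> 'I_n.+1) ?tnth0//; exact: val_inj.
rewrite (@row_mxEr _ 1 1 n) mxE.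
by rewrite (_ : @rshift 1 n j = lift ord0 j :> 'I_n.+1) ?tnthS//; exact: val_inj.
Qed.

Lemma rvolS n (S : set 'rV[R]_n.+1) :
  rvol S = (\int[leb]_t rvol [set x | S (row_cons t x)])%E.
Proof.
rewrite /rvol /= /pushforward /product_measure1; apply: eq_integral => t _ /=.
congr (mu n _); apply/seteqP; split=> p; rewrite /xsection /= inE /=.
  by rewrite -rowt_tcons.
by rewrite -rowt_tcons.
Qed.

Lemma rmeas_prod n (S : set 'rV[R]_n.+1) : rmeas S ->
  measurable [set p : T * n.-tuple T | S (row_cons p.1 (rowt p.2))].
Proof.
move=> /measurable_preimage_tcons; congr measurable.
by apply/seteqP; split=> -[t p] /=; rewrite -rowt_tcons.
Qed.

Lemma rmeas_slice n (S : set 'rV[R]_n.+1) t : rmeas S ->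
  rmeas [set x | S (row_cons t x)].
Proof.
move=> /rmeas_prod /(measurable_xsection t).
by congr measurable; apply/seteqP; split=> p; rewrite /xsection /= inE.
Qed.

Lemma measurable_slice n (S : set 'rV[R]_n.+1) (p : n.-tuple T) : rmeas S ->
  measurable ([set t | S (row_cons t (rowt p))] : set T).
Proof.
move=> /rmeas_prod /(measurable_ysection p).
by congr measurable; apply/seteqP; split=> t; rewrite /ysection /= inE.
Qed.

Lemma measurable_rvol_slice n (S : set 'rV[R]_n.+1) : rmeas S ->
  measurable_fun setT (fun t : T => rvol [set x | S (row_cons t x)]).
Proof.
move=> /rmeas_prod /(measurable_fun_xsection (mu n)); congr measurable_fun.
apply/funext => t /=; congr (mu n _).
by apply/seteqP; split=> p; rewrite /xsection /= inE.
Qed.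

(** Slicing along the first coordinate instead; this is Tonelli's theorem. *)
Lemma rvolS_swap n (S : set 'rV[R]_n.+1) : rmeas S ->
  rvol S = (\int[mu n]_p leb [set t | S (row_cons t (rowt p))])%E.
Proof.
move=> mS; have mP := rmeas_prod mS.
rewrite rvolS; pose P := [set p : T * n.-tuple T | S (row_cons p.1 (rowt p.2))].
transitivity ((leb \x mu n)%E P).
  apply: eq_integral => t _ /=; congr (mu n _).
  by apply/seteqP; split=> p; rewrite /xsection /= inE.
rewrite (product_measure_swap leb (mu n))//.
apply: eq_integral => p _ /=; congr (leb _).
by apply/seteqP; split=> t; rewrite /ysection /= inE.
Qed.

Lemma measurable_leb_slice n (S : set 'rV[R]_n.+1) : rmeas S ->
  measurable_fun setT (fun p : n.-tuple T => leb [set t | S (row_cons t (rowt p))]).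
Proof.
move=> /rmeas_prod /(measurable_fun_ysection leb); congr measurable_fun.
apply/funext => p /=; congr (leb _).
by apply/seteqP; split=> t; rewrite /ysection /= inE.
Qed.

Lemma le_rvol n (S S' : set 'rV[R]_n) : S `<=` S' -> (rvol S <= rvol S')%E.
Proof.
elim: n S S' => [|n IH] S S' SS'.
  rewrite /rvol /= !diracE lee_fin ler_nat; case: (boolP (_ \in _ @^-1` S)) => // pS.
  by rewrite (_ : _ \in _ = true)//; apply/mem_set/SS'; move/set_mem: pS.
rewrite !rvolS; apply: le_integral_any => t; first exact: rvol_ge0.
by apply: IH => x; exact: SS'.
Qed.

End RowVolume.

(** * Affine changes of variables *)

Section AffineLine.
Context {R : realType}.
Local Notation T := (measurableTypeR R).
Local Notation leb := (@lebesgue_measure R).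
Variables a b : R.
Hypothesis a0 : a != 0.

Let affine (t : T) : T := a * t + b.

Let measurable_affine : measurable_fun setT affine.
Proof. by apply: measurable_funD => //; apply: measurable_funM. Qed.

(** The measure to which uniqueness of the Lebesgue measure is applied, up to the
    factor |a|. *)
Definition affine_leb (S : set T) : \bar R := leb (affine @^-1` S).

Let affine0 : affine_leb set0 = 0%E.
Proof. by rewrite /affine_leb preimage_set0 measure0. Qed.
Let affine_ge0 S : (0 <= affine_leb S)%E. Proof. exact: measure_ge0. Qed.
Let affine_additive : semi_sigma_additive affine_leb.
Proof.
have mpre S : measurable S -> measurable (affine @^-1` S).
  by move=> mS; rewrite -[X in measurable X]setTI; exact: measurable_affine.
move=> F mF tF mUF; rewrite /affine_leb preimage_bigcup.
apply: measure_semi_sigma_additive => [k||]; first exact: mpre.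
- apply/trivIsetP => i j _ _ ij; rewrite -preimage_setI.
  by move/trivIsetP : tF => /(_ _ _ _ _ ij) ->//; rewrite preimage_set0.
- by rewrite -preimage_bigcup; exact: mpre.
Qed.

HB.instance Definition _ := isMeasure.Build _ _ _ affine_leb
  affine0 affine_ge0 affine_additive.

Lemma lebesgue_affine (S : set T) : measurable S ->
  (leb [set t | S (a * t + b)%R] = `|a|^-1%:E * leb S)%E.
Proof.
move=> mS; pose m := mscale (NngNum (normr_ge0 a)) affine_leb.
have -> : leb S = m S.
  apply: lebesgue_measure_unique mS => _ [[x y] _ <-].
  rewrite -[RHS]/((`|a|%:E * leb (affine @^-1` `]x, y]%classic))%E).
  have aN : `|a| != 0 by rewrite normr_eq0.
  have [a_gt0|a_lt0] := ltP 0 a.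
        rewrite (_ : affine @^-1` _ = [set` `](x - b) / a, (y - b) / a]]); last first.
      apply/seteqP; split=> t /=; rewrite /affine !in_itv/=.
        by rewrite ltr_pdivrMr// ler_pdivlMr// ltrBlDr lerBrDr mulrC.
      by rewrite ltr_pdivrMr// ler_pdivlMr// ltrBlDr lerBrDr mulrC.
    rewrite !lebesgue_measure_itv /= !lte_fin ltr_pM2r ?invr_gt0// ltrD2r.
    case: ifPn => _; last by rewrite mule0.
    by rewrite -!EFinB -EFinM gtr0_norm//; congr EFin; field.
  have {a_lt0}a_lt0 : a < 0 by rewrite lt_neqAle a0.
  rewrite (_ : affine @^-1` _ = [set` `[(y - b) / a, (x - b) / a[]); last first.
    apply/seteqP; split=> t /=; rewrite /affine !in_itv/=.
      by rewrite ler_ndivrMr// ltr_ndivlMr// ltrBlDr lerBrDr mulrC andbC.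
    by rewrite ler_ndivrMr// ltr_ndivlMr// ltrBlDr lerBrDr mulrC andbC.
  rewrite !lebesgue_measure_itv /= !lte_fin ltr_nM2r ?invr_lt0// ltrD2r.
  case: ifPn => _; last by rewrite mule0.
  by rewrite -!EFinB -EFinM ltr0_norm//; congr EFin; field.
by rewrite /m /mscale /= muleA -EFinM mulVf ?normr_eq0// mul1e.
Qed.

End AffineLine.

Section LinearVolume.
Context {R : realType}.
Local Notation T := (measurableTypeR R).
Local Notation leb := (@lebesgue_measure R).
Local Notation mu n := (@lebesgue_tuple R n).

Definition rhead n (z : 'rV[R]_n.+1) : R := z 0 ord0.
Definition rtail n (z : 'rV[R]_n.+1) : 'rV[R]_n := rsubmx (z : 'rV_(1 + n)).

Lemma rhead_cons n t (x : 'rV[R]_n) : rhead (row_cons t x) = t.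
Proof.
rewrite /rhead /row_cons (_ : ord0 = @lshift 1 n ord0) ?(@row_mxEl _ 1 1 n).
  by rewrite mxE mulr1n.
exact: val_inj.
Qed.

Lemma rtail_cons n t (x : 'rV[R]_n) : rtail (row_cons t x) = x.
Proof. exact: row_mxKr. Qed.

Lemma row_cons_eta n (z : 'rV[R]_n.+1) : z = row_cons (rhead z) (rtail z).
Proof.
suff E : (rhead z)%:M = lsubmx (z : 'rV_(1 + n)).
  by rewrite /row_cons E (@hsubmxK _ 1 1 n).
apply/matrixP => i j; rewrite !ord1 !mxE mulr1n /rhead; congr (z _ _).
exact: val_inj.
Qed.

(** The change of variables formula for G.  Translations are included because the
    induction on the dimension produces them in the slices. *)
Definition affine_scaling n (G : 'M[R]_n) := forall v (S : set 'rV[R]_n), rmeas S ->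
  rvol [set x | S (x *m G + v)] = (`|\det G|^-1%:E * rvol S)%E.

Lemma affine_scalingM n (G H : 'M[R]_n) :
  affine_scaling G -> affine_scaling H -> affine_scaling (G *m H).
Proof.
move=> sG sH v S mS.
have mS' : rmeas [set y | S (y *m H + v)] by exact: rmeas_affine.
have := sG 0 _ mS'; rewrite sH// => sGH.
rewrite det_mulmx normrM invfM EFinM -muleA -sGH; congr (rvol _).
by apply/seteqP; split=> x /=; rewrite addr0 mulmxA.
Qed.

(** A block triangular map fixing the first coordinate acts on each slice by an
    affine map of linear part D. *)
Lemma rvol_shear_tail n (D : 'M[R]_n) (b w : 'rV[R]_n) (S : set 'rV[R]_n.+1) :
  affine_scaling D -> rmeas S ->
  rvol [set z : 'rV[R]_n.+1 | S (row_cons (rhead z)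
     (rtail z *m D + (rhead z *: b + w)))] =
  (`|\det D|^-1%:E * rvol S)%E.
Proof.
move=> sD mS; rewrite rvolS [in RHS]rvolS -ge0_integralZl//.
2: exact: measurable_rvol_slice.
apply: eq_integral => t _.
rewrite -(sD (t *: b + w)); last exact: rmeas_slice.
congr (rvol _); apply/seteqP; split=> x /=.
all: by rewrite rhead_cons rtail_cons.
Qed.

Lemma shear_headE n (g : 'cV[R]_n) (a e : R) (z : 'rV[R]_n.+1) :
  row_cons (a * rhead z + ((rtail z *m g) 0 0 + e)) (rtail z) =
  z *m (block_mx (a%:M : 'M[R]_1) 0 g 1%:M : 'M[R]_n.+1) + row_cons e 0.
Proof.
rewrite [in RHS](row_cons_eta z) (@mul_row_block _ 1 1 n 1 n) mulmx0 add0r mulmx1.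
rewrite /row_cons (@add_row_mx _ 1 1 n) addr0 -scalar_mxM.
apply: (f_equal2 (@row_mx R 1 1 n)) => //.
by apply/matrixP => i j; rewrite !ord1 !mxE eqxx !mulr1n; ring.
Qed.

Lemma rmeas_shear_head n (g : 'cV[R]_n) (a e : R) (S : set 'rV[R]_n.+1) :
  rmeas S -> rmeas [set z : 'rV[R]_n.+1 |
    S (row_cons (a * rhead z + ((rtail z *m g) 0 0 + e)) (rtail z))].
Proof.
move=> mS; have := @rmeas_affine R n.+1 n.+1 _ (row_cons e 0) S mS.
move=> /(_ (block_mx (a%:M : 'M[R]_1) 0 g 1%:M)); congr rmeas.
by apply/funext => z; rewrite /= shear_headE.
Qed.

(** A block triangular map moving only the first coordinate acts on each line
    parallel to the first axis by an affine map of slope a. *)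
Lemma rvol_shear_head n (g : 'cV[R]_n) (a e : R) (S : set 'rV[R]_n.+1) :
  a != 0 -> rmeas S ->
  rvol [set z : 'rV[R]_n.+1 | S (row_cons
     (a * rhead z + ((rtail z *m g) 0 0 + e)) (rtail z))] =
  (`|a|^-1%:E * rvol S)%E.
Proof.
move=> a0 mS.
rewrite [in RHS]rvolS_swap// rvolS_swap; last exact: rmeas_shear_head.
rewrite -ge0_integralZl//.
2: exact: measurable_leb_slice.
apply: eq_integral => p _.
rewrite -(lebesgue_affine ((rowt p *m g) 0 0 + e) a0); last exact: measurable_slice.
congr (leb _); apply/seteqP; split=> t /=; by rewrite rhead_cons rtail_cons.
Qed.

(** Adding to the last columns a multiple of the first one makes the lower right
    block invertible; the row b of the matrix itself serves as multiplier.  If x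
    kills D + c b and u spans a null column of D, then b u <> 0 and the scalar
    (x c)(b u) vanishes, so x kills c and D and (0, x) kills the whole matrix. *)
Lemma unitmx_shear n (a : R) (b : 'rV[R]_n) (c : 'cV[R]_n) (D : 'M[R]_n) :
  block_mx (a%:M : 'M[R]_1) b c D \in unitmx -> D \notin unitmx ->
  D + c *m b \in unitmx.
Proof.
move=> uG; rewrite unitmxE unitfE negbK => detD.
have [u u0 Du] : exists2 u : 'cV[R]_n, u != 0 & D *m u = 0.
  have /det0P[w w0 wD] : \det D^T == 0 by rewrite det_tr.
  exists w^T; first by rewrite -(inj_eq trmx_inj) trmxK trmx0.
  by apply: trmx_inj; rewrite trmx_mul trmxK trmx0.
have bu : (b *m u) 0 0 != 0.
  apply: contra u0 => /eqP bu0.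
  have := mulKmx uG (col_mx 0 u); rewrite mul_block_col !mulmx0 !add0r Du.
  rewrite [b *m u]mx11_scalar bu0 raddf0 col_mx0 mulmx0 => /esym/eqP.
  by rewrite col_mx_eq0 => /andP[].
rewrite unitmxE unitfE; apply/negP => /det0P[x x0].
rewrite mulmxDr mulmxA => xDcb.
have xc : x *m c = 0.
  have := congr1 (fun y => (y *m u) 0 0) xDcb.
  rewrite mulmxDl -!mulmxA Du mulmx0 add0r mul0mx [RHS]mxE mulmxA.
  rewrite [x *m c]mx11_scalar mul_scalar_mx mxE => /eqP.
  by rewrite mulf_eq0 (negPf bu) orbF => /eqP ->; rewrite raddf0.
move: xDcb; rewrite xc mul0mx addr0 => xD.
have := mulmxK uG (row_mx 0 x); rewrite mul_row_block !mul0mx !add0r xc xD.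
by rewrite row_mx0 mul0mx => /esym/eqP; rewrite row_mx_eq0 (negPf x0) andbF.
Qed.

(** Induction on the dimension.  When the lower right block D is invertible, the
    matrix is the product of a block triangular matrix fixing the first
    coordinate and one moving only that coordinate.  The general case reduces to
    this one by a shear E. *)
Theorem affine_scaling_unit n (G : 'M[R]_n) : G \in unitmx -> affine_scaling G.
Proof.
elim: n G => [|n IH] G uG.
  move=> v S _; rewrite det_mx00 normr1 invr1 mul1e; congr (rvol _).
  by apply/seteqP; split=> x /=; rewrite [x *m G + v]thinmx0 [x]thinmx0.
have blockD (a : R) (b : 'rV[R]_n) (c : 'cV[R]_n) (D : 'M[R]_n) :
    block_mx (a%:M : 'M[R]_1) b c D \in unitmx -> D \in unitmx ->
    @affine_scaling n.+1 (block_mx (a%:M : 'M[R]_1) b c D).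
  move=> uB uD v S mS.
  have [g gD] : exists g, D *m g = c by exists (invmx D *m c); rewrite mulKVmx.
  pose al := a - (b *m g) 0 0.
  have detB : \det (block_mx (a%:M : 'M[R]_1) b c D) = \det D * al.
    have -> : block_mx (a%:M : 'M[R]_1) b c D =
        block_mx 1%:M b 0 D *m block_mx (al%:M : 'M[R]_1) 0 g 1%:M.
      rewrite mulmx_block !mul0mx !mul1mx !mulmx1 !add0r gD.
      rewrite [b *m g]mx11_scalar -raddfD/= subrK.
      by congr block_mx.
    by rewrite det_mulmx det_ublock det_lblock !det1 mul1r mulr1 det_scalar1.
  have al0 : al != 0.
    by move: uB; rewrite unitmxE unitfE detB mulf_eq0 => /norP[].
  rewrite detB normrM invfM EFinM -muleA.
  pose e := rhead v - (rtail v *m g) 0 0.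
  rewrite -(rvol_shear_head g e al0 mS).
  rewrite -(rvol_shear_tail b (rtail v) (IH D uD)); last exact: rmeas_shear_head.
  congr (rvol _); apply/funext => z; congr S.
  rewrite !rhead_cons !rtail_cons {1}(row_cons_eta z) {1}(row_cons_eta v).
  rewrite /row_cons (@mul_row_block _ 1 1 n 1 n) (@add_row_mx _ 1 1 n).
  apply: (f_equal2 (@row_mx R 1 1 n)).
    apply/matrixP => i j; rewrite !ord1 -gD.
    rewrite !mulmxDl -!scalemxAl !mulmxA /e /al -scalar_mxM.
    by rewrite !mxE eqxx !mulr1n; ring.
  by rewrite mul_scalar_mx addrA [X in X + _ = _]addrC.
pose H : 'M[R]_(1 + n) := G; have HG : block_mx ((H 0 0)%:M : 'M[R]_1) (ursubmx H)
    (dlsubmx H) (drsubmx H) = H.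
  rewrite -[RHS]submxK; congr block_mx; rewrite [RHS]mx11_scalar !mxE.
  by congr ((H _ _)%:M); exact: val_inj.
have uH : block_mx ((H 0 0)%:M : 'M[R]_1) (ursubmx H) (dlsubmx H) (drsubmx H) \in unitmx.
  by rewrite HG.
have [uD|nuD] := boolP (drsubmx H \in unitmx).
  by have := blockD _ _ _ _ uH uD; rewrite HG.
set b := ursubmx H in HG uH *; set c := dlsubmx H in HG uH *.
set D := drsubmx H in HG uH nuD *; set a := H 0 0 in HG uH *.
pose E (v : 'rV[R]_n) : 'M[R]_(1 + n) := block_mx (1%:M : 'M[R]_1) v 0 1%:M.
have uE v : E v \in unitmx by rewrite unitmxE det_ublock !det1 mulr1 unitr1.
have HE : H *m E b = block_mx (a%:M : 'M[R]_1) (a *: b + b) c (D + c *m b).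
  rewrite -HG mulmx_block !mulmx1 !mulmx0 !addr0 mul_scalar_mx.
  by congr block_mx; rewrite addrC.
have HEE : H = (H *m E b) *m E (- b).
  rewrite -mulmxA [E b *m _]mulmx_block !mulmx1 !mulmx0 !mul0mx !mul1mx !addr0 !add0r.
  by rewrite addNr -scalar_mx_block mulmx1.
suff : affine_scaling (H *m E b *m E (- b) : 'M[R]_n.+1) by rewrite -HEE.
apply: affine_scalingM; last first.
  by apply: blockD; [exact: uE|exact: unitmx1].
have uHE : H *m E b \in unitmx by rewrite unitmx_mul uE andbT; exact: uG.
rewrite HE in uHE *; apply: blockD uHE _.
exact: unitmx_shear uH nuD.
Qed.

End LinearVolume.

(** * Volume of coordinatewise products *)

Section Plane.
Context {R : realType}.
Local Notation T := (measurableTypeR R).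
Local Notation leb := (@lebesgue_measure R).

Definition plane_leb : set (T * T) -> \bar R := (leb \x leb)%E.
HB.instance Definition _ := Measure.on plane_leb.

Let plane_sigma_finite : sigma_finite setT plane_leb.
Proof.
have /sigma_finiteP[F [FT ndF Foo]] := sigma_finiteT leb.
exists (fun k => F k `*` F k); last first.
  move=> k; have [mF Fk] := Foo k; split; first exact: measurableX.
  by rewrite /plane_leb product_measure1E// lte_mul_pinfty// ge0_fin_numE.
apply/esym; rewrite -subTset => -[x y] _.
have [i _ Fx] : (\bigcup_i F i) x by rewrite -FT.
have [j _ Fy] : (\bigcup_i F i) y by rewrite -FT.
exists (maxn i j) => //; split; move: Fx Fy => /= Fx Fy.
  by move: x Fx; apply/subsetPset/ndF/leq_maxl.
by move: y Fy; apply/subsetPset/ndF/leq_maxr.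
Qed.
HB.instance Definition _ := Measure_isSigmaFinite.Build _ _ _ plane_leb
  plane_sigma_finite.

Lemma integral_plane_prod (a b : T -> \bar R) :
  measurable_fun setT a -> measurable_fun setT b ->
  (forall t, 0 <= a t)%E -> (forall t, 0 <= b t)%E ->
  (\int[plane_leb]_z (a z.1 * b z.2) = \int[leb]_t a t * \int[leb]_s b s)%E.
Proof.
move=> ma mb a0 b0.
rewrite (@fubini_tonelli1 _ _ _ _ _ leb leb (fun z => a z.1 * b z.2)%E); last 2 first.
- by apply: emeasurable_funM; exact: measurableT_comp.
- by move=> z; exact: mule_ge0.
rewrite -ge0_integralZr//; last exact: integral_ge0.
by apply: eq_integral => t _; rewrite /fubini_F /= ge0_integralZl.
Qed.

Lemma rectangle_le_plane (c d : R) (W : set (T * T)) : 0 <= c -> 0 <= d ->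
  measurable W -> (forall t s, `|t| < c -> `|s| < d -> W (t, s)) ->
  ((4 * (c * d))%:E <= plane_leb W)%E.
Proof.
move=> c0 d0 mW cdW.
have -> : (4 * (c * d))%:E = plane_leb (`]- c, c[%classic `*` `]- d, d[%classic).
  rewrite /plane_leb product_measure1E//= !lebesgue_measure_itv/= !lte_fin.
  case: (ltP (- c) c) => cc; last first.
    by rewrite mul0e (_ : c = 0) ?mul0r ?mulr0//; lra.
  case: (ltP (- d) d) => dd; last first.
    by rewrite mule0 (_ : d = 0) ?mulr0//; lra.
  by rewrite -!EFinB -EFinM; congr EFin; ring.
apply: le_measure; rewrite ?inE//; first exact: measurableX.
move=> [t s] [/=]; rewrite !in_itv/= -!ltr_norml; exact: cdW.
Qed.

End Plane.

Section Hulls.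
Context {R : realType}.
Local Notation T := (measurableTypeR R).
Local Notation leb := (@lebesgue_measure R).
Local Notation mu n := (@lebesgue_tuple R n).
Local Notation "x %:r" := (ratr x : R) (at level 2, format "x %:r").

(** The solid open set spanned by a set Q of rational points: a union of countably
    many boxes, so that it is measurable for every Q. *)
Definition hull n (Q : set 'rV[rat]_n) : set 'rV[R]_n :=
  [set x | exists q, Q q /\ forall i, `|x 0 i| < (q 0 i)%:r].

Definition prodbox n (q r : 'rV[rat]_n) : set 'rV[R]_n :=
  [set p | forall i, [/\ 0 < (q 0 i)%:r, 0 < (r 0 i)%:r, 0 < p 0 i &
    p 0 i < (q 0 i)%:r * (r 0 i)%:r]].

(** The coordinatewise products of positive points of [hull Q1] and [hull Q2]. *)
Definition prodhull n (Q1 Q2 : set 'rV[rat]_n) : set 'rV[R]_n :=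
  [set p | exists qr : 'rV[rat]_n * 'rV[rat]_n,
     (Q1 qr.1 /\ Q2 qr.2) /\ prodbox qr.1 qr.2 p].

Lemma rmeas_if n (P : Prop) (S : set 'rV[R]_n) : rmeas S ->
  rmeas [set x | P /\ S x].
Proof.
move=> mS; have [p|np] := pselect P.
  by rewrite (_ : [set x | _] = S)//; apply/seteqP; split=> x /=; [case|].
rewrite (_ : [set x | _] = set0); last by apply/seteqP; split=> x // [].
by rewrite /rmeas preimage_set0.
Qed.

Lemma rmeas_hull n (Q : set 'rV[rat]_n) : rmeas (hull Q).
Proof.
apply: rmeas_bigcup => q; apply: rmeas_if.
apply: (@rmeas_coords _ _ (fun i => [set t : R | `|t| < (q 0 i)%:r])) => i.
rewrite (_ : [set t | _] = `]- (q 0 i)%:r, (q 0 i)%:r[%classic)//.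
by apply/seteqP; split=> t /=; rewrite in_itv/= ltr_norml.
Qed.

Lemma rmeas_prodbox n (q r : 'rV[rat]_n) : rmeas (prodbox q r).
Proof.
apply: (@rmeas_coords _ _ (fun i => [set t : R | [/\ 0 < (q 0 i)%:r, 0 < (r 0 i)%:r,
  0 < t & t < (q 0 i)%:r * (r 0 i)%:r]])) => i.
have [[q0 r0]|qr] := pselect (0 < (q 0 i)%:r /\ 0 < (r 0 i)%:r).
  rewrite (_ : [set t | _] = `]0, (q 0 i)%:r * (r 0 i)%:r[%classic)//.
  apply/seteqP; split=> t /=; rewrite in_itv/=; first by case=> _ _ -> ->.
  by move=> /andP[].
by rewrite (_ : [set t | _] = set0)//; apply/seteqP; split=> t //= [? ? _ _]; exact: qr.
Qed.

Lemma rmeas_prodhull n (Q1 Q2 : set 'rV[rat]_n) : rmeas (prodhull Q1 Q2).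
Proof.
by apply: rmeas_bigcup => -[q r] /=; apply: rmeas_if; exact: rmeas_prodbox.
Qed.

Lemma forall_ordS n (P : 'I_n.+1 -> Prop) :
  (forall i, P i) <-> P ord0 /\ forall i : 'I_n, P (lift ord0 i).
Proof.
split=> [h|[h0 h] i]; first by split=> [|i]; exact: h.
by case: (unliftP ord0 i) => [j|] ->.
Qed.

Definition qtail n (q : 'rV[rat]_n.+1) : 'rV[rat]_n := \row_i q 0 (lift ord0 i).

(** The rational points spanning the slice of [hull Q] at t. *)
Definition qslice n (Q : set 'rV[rat]_n.+1) (t : R) : set 'rV[rat]_n :=
  [set q' | exists q, Q q /\ `|t| < (q 0 ord0)%:r /\ q' = qtail q].

Lemma row_cons_ord0 n t (x : 'rV[R]_n) : row_cons t x 0 ord0 = t.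
Proof. exact: rhead_cons. Qed.

Lemma row_cons_lift n t (x : 'rV[R]_n) i : row_cons t x 0 (lift ord0 i) = x 0 i.
Proof.
rewrite /row_cons (_ : lift ord0 i = @rshift 1 n i) ?(@row_mxEr _ 1 1 n)//.
exact: val_inj.
Qed.

Lemma hull_slice n (Q : set 'rV[rat]_n.+1) t :
  [set x | hull Q (row_cons t x)] = hull (qslice Q t).
Proof.
apply/seteqP; split=> x /=.
  move=> [q [Qq /forall_ordS[]]]; rewrite row_cons_ord0 => tq h.
  exists (qtail q); split; first by exists q.
  by move=> i; have := h i; rewrite row_cons_lift mxE.
move=> [q' [[q [Qq [tq ->]]] h]]; exists q; split=> //.
apply/forall_ordS; rewrite row_cons_ord0; split=> // i.
by have := h i; rewrite row_cons_lift mxE.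
Qed.

Lemma measurable_prodhull_slices n (Q1 Q2 : set 'rV[rat]_n.+1) :
  measurable [set z : (T * T) * n.-tuple T |
    prodhull (qslice Q1 z.1.1) (qslice Q2 z.1.2) (rowt z.2)].
Proof.
pose Y (qr : 'rV[rat]_n.+1 * 'rV[rat]_n.+1) : set ((T * T) * n.-tuple T) :=
  (`]- (qr.1 0 ord0)%:r, (qr.1 0 ord0)%:r[%classic `*`
   `]- (qr.2 0 ord0)%:r, (qr.2 0 ord0)%:r[%classic) `*`
  (@rowt R n @^-1` prodbox (qtail qr.1) (qtail qr.2)).
rewrite (_ : [set z | _] = \bigcup_(qr in [set: 'rV[rat]_n.+1 * 'rV[rat]_n.+1])
    [set z | (Q1 qr.1 /\ Q2 qr.2) /\ Y qr z]).
  apply: countable_bigcupT_measurable => [|qr]; first exact: countableP.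
  have mY : measurable (Y qr).
    by apply: measurableX; [exact: measurableX|exact: rmeas_prodbox].
  have [PQ|nPQ] := pselect (Q1 qr.1 /\ Q2 qr.2).
    by rewrite (_ : [set z | _] = Y qr)//; apply/seteqP; split=> z /=; [case|].
  by rewrite (_ : [set z | _] = set0)//; apply/seteqP; split=> z // [].
apply/seteqP; split=> -[[t s] p] /=.
  move=> [[_ _] /= [[[q [Qq [tq ->]]] [r [Qr [sr ->]]]] h]].
  exists (q, r) => //=; split=> //; split=> //=.
  by rewrite !in_itv/= -!ltr_norml.
move=> [[q r] _ /= [[Qq Qr] [[/=]]]]; rewrite !in_itv/= -!ltr_norml => tq sr h.
by exists (qtail q, qtail r) => //=; split=> //; split; [exists q|exists r].
Qed.

(** Induction on the dimension.  The product of the volumes is an integral over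
    the first coordinates (t, s) of products of volumes of slices, to which the
    induction hypothesis applies.  Exchanging the order of integration leaves,
    for a fixed tail p of the product point, the area of the set of the (t, s)
    whose slices have p among their products.  This set contains a rectangle
    with sides 2c and 2d for each admissible pair (c, d), and hence has area at
    least four times the length of the interval of the first coordinates of the
    products with tail p. *)
Theorem hull_product n (Q1 Q2 : set 'rV[rat]_n) :
  ((4 ^+ n)%:E * rvol (prodhull Q1 Q2) <= rvol (hull Q1) * rvol (hull Q2))%E.
Proof.
elim: n Q1 Q2 => [|n IH] Q1 Q2.
  rewrite expr0 mul1e /rvol /= !diracE -EFinM lee_fin -natrM ler_nat.
  case: (boolP (_ \in _ @^-1` prodhull _ _)) => //.
  move=> /set_mem[qr [[Qq Qr] _]].
  rewrite (_ : _ \in _ @^-1` hull Q1 = true); last first.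
    by apply/mem_set; exists qr.1; split=> // -[].
  rewrite (_ : _ \in _ @^-1` hull Q2 = true)//.
  by apply/mem_set; exists qr.2; split=> // -[].
pose X := [set z : (T * T) * n.-tuple T |
    prodhull (qslice Q1 z.1.1) (qslice Q2 z.1.2) (rowt z.2)].
have mX : measurable X := measurable_prodhull_slices Q1 Q2.
pose L p := [set t : T | prodhull Q1 Q2 (row_cons t (rowt p))].
have LX p : (4%:E * leb (L p) <= plane_leb (ysection X p))%E.
  set B := plane_leb _; have B0 : (0 <= B)%E by exact: measure_ge0.
  have [[b Bb]|BN] : (exists b, B = b%:E) \/ B = +oo%E.
  - by case: B B0 => [b _||]; [left; exists b|right|].
  2: by rewrite BN leey.
  have b0 : 0 <= b by move: B0; rewrite Bb lee_fin.
  have Lb : L p `<=` `]0, b / 4[%classic.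
    move=> t [[q r] /= [[Qq Qr] /forall_ordS[]]].
    rewrite row_cons_ord0 in_itv/= => -[q0 r0 -> tqr] h /=.
    rewrite (lt_le_trans tqr)// ler_pdivlMr// mulrC -lee_fin -Bb.
    apply: rectangle_le_plane (ltW q0) (ltW r0) _ _.
      exact: measurable_ysection.
    move=> u v uq vr; rewrite /ysection /= inE; exists (qtail q, qtail r) => /=.
    split; first by split; [exists q|exists r].
    by move=> i; have := h i; rewrite row_cons_lift !mxE.
  apply: (@le_trans _ _ (4%:E * leb `]0%R, (b / 4)%R[%classic)%E).
    apply: lee_wpmul2l => //; apply: le_measure; rewrite ?inE//.
    exact: (measurable_slice p (rmeas_prodhull Q1 Q2)).
  rewrite lebesgue_measure_itv/= lte_fin Bb; case: ifPn => _.
    by rewrite -EFinB -EFinM lee_fin subr0 mulrC divfK.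
  by rewrite mule0 lee_fin.
have n4 : (0 <= (4 ^+ n)%:E :> \bar R)%E by rewrite lee_fin exprn_ge0.
have mPH := rmeas_prodhull Q1 Q2.
apply: (@le_trans _ _ ((4 ^+ n)%:E * (plane_leb \x^ mu n) X)%E).
  rewrite exprSr EFinM -muleA; apply: lee_wpmul2l => //.
  rewrite rvolS_swap// -ge0_integralZl//.
  2: exact: measurable_leb_slice.
  by apply: le_integral_any => p; [rewrite mule_ge0|exact: LX].
rewrite -product_measure_swap// /product_measure1.
rewrite -ge0_integralZl//.
2: exact: measurable_fun_xsection.
rewrite [X in (_ <= X * _)%E]rvolS [X in (_ <= _ * X)%E]rvolS.
have mh Q := measurable_rvol_slice (rmeas_hull Q : @rmeas R n.+1 _).
rewrite -(integral_plane_prod (mh Q1) (mh Q2)); try by move=> t; exact: rvol_ge0.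
apply: le_integral_any => -[t s] /=; first by rewrite mule_ge0.
rewrite !hull_slice; apply: le_trans (IH _ _).
apply: lee_wpmul2l => //.
rewrite le_eqVlt; apply/orP; left; apply/eqP; congr (mu n _).
by apply/seteqP; split=> p; rewrite /xsection /= inE.
Qed.

End Hulls.

(** * The volume of the simplex *)

Section Simplex.
Context {R : realType}.
Local Notation T := (measurableTypeR R).
Local Notation leb := (@lebesgue_measure R).

Definition simplex n (r : R) : set 'rV[R]_n :=
  [set p | (forall i, 0 < p 0 i) /\ \sum_i p 0 i < r].

Lemma simplex_slice n (r t : R) :
  [set x | simplex r (row_cons t x)] =
  if 0 < t then simplex (r - t) else set0 :> set 'rV[R]_n.
Proof.
apply/seteqP; split=> x /=; rewrite /simplex /= forall_ordS row_cons_ord0 big_ord_recl row_cons_ord0.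
  under eq_bigr do rewrite row_cons_lift.
  move=> [[t0 x0] tx]; rewrite t0 /= ltrBrDl; split=> // i.
  by have := x0 i; rewrite row_cons_lift.
under [in X in _ -> X]eq_bigr do rewrite row_cons_lift.
case: ifPn => // t0 [x0]; rewrite ltrBrDl => tx; split=> //; split=> // i.
by rewrite row_cons_lift.
Qed.

Lemma simplex_le0 n (r : R) : r <= 0 -> simplex r = set0 :> set 'rV[R]_n.
Proof.
move=> r0; apply/seteqP; split=> // p [p0 pr].
have : 0 <= \sum_i p 0 i by apply: sumr_ge0 => i _; exact/ltW/p0.
by rewrite leNgt (lt_le_trans pr).
Qed.

Lemma continuous_subr_exp n (r c : R) :
  continuous (fun t : R => (r - t) ^+ n / c).
Proof.
move=> x; apply: cvgM; last exact: cvg_cst.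
apply: (@continuous_comp _ _ _ (fun t : R => r - t) (fun y : R => y ^+ n)).
  by apply: cvgB; [exact: cvg_cst|exact: cvg_id].
exact: exprn_continuous.
Qed.

Lemma integral_simplex_slice n (r : R) : 0 < r ->
  (\int[leb]_(t in `[0%R, r]) ((r - t) ^+ n / n`!%:R)%:E = (r ^+ n.+1 / n.+1`!%:R)%:E)%E.
Proof.
move=> r0; pose F (t : R) : R := - ((r - t) ^+ n.+1 / n.+1`!%:R).
have dF (x : R) : is_derive x 1 F ((r - x) ^+ n / n`!%:R).
  have := is_deriveZ (- (n.+1`!%:R)^-1) (is_deriveX n.+1
    (is_deriveB (is_derive_cst r x 1) (is_derive_id x 1))).
  rewrite /GRing.scale/= => d.
  have -> : F = - (n.+1`!%:R)^-1 \*: ((cst r - id) ^+ n.+1).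
    apply/funext => t; rewrite /F /= /GRing.scale/= mulNr [in RHS]mulrC.
    by rewrite fctE.
  apply: (is_derive_eq d).
  rewrite factS natrM /=; field.
  by rewrite [1 + _]addrC natr1 !pnatr_eq0 -lt0n fact_gt0.
have cg : continuous (fun t : R => (r - t) ^+ n / n`!%:R).
  exact: continuous_subr_exp.
have cF : continuous F.
  by move=> y; apply/differentiable_continuous/derivable1_diffP; case: (dF y).
rewrite (@continuous_FTC2 _ (fun t => (r - t) ^+ n / n`!%:R) F)//.
- rewrite -EFinB; congr EFin.
  by rewrite /F subrr expr0n /= subr0 mul0r oppr0 sub0r opprK.
- exact/continuous_subspaceT/cg.
- split=> [x _||]; first by case: (dF x).
    by apply: cvg_at_right_filter; exact: cF.
  by apply: cvg_at_left_filter; exact: cF.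
- by move=> x _; rewrite derive1E; case: (dF x).
Qed.

Lemma rvol_simplex n (r : R) : 0 < r ->
  rvol (simplex r : set 'rV[R]_n) = (r ^+ n / n`!%:R)%:E.
Proof.
elim: n r => [|n IH] r r0.
  rewrite expr0 fact0 divr1 /rvol /= diracE (_ : _ \in _ = true)//.
  by apply/mem_set; split=> [[]//|]; rewrite big_ord0.
rewrite -integral_simplex_slice// rvolS.
rewrite (@integral_itv_bndoo _ _ _ _ true false); last first.
  apply/measurable_EFinP; apply: measurable_funTS.
  by apply: continuous_measurable_fun; exact: continuous_subr_exp.
rewrite [RHS]integral_mkcond; apply: eq_integral => t _.
rewrite simplex_slice patchE; case: ifPn => t0; last first.
  rewrite memNset; first by rewrite /rvol preimage_set0 measure0.
  by rewrite /= in_itv/= (negPf t0).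
have [tr|rt] := ltP t r.
  rewrite mem_set; last by rewrite /= in_itv/= t0 tr.
  by rewrite IH// subr_gt0.
rewrite simplex_le0 ?subr_le0// memNset.
  by rewrite /rvol preimage_set0 measure0.
by rewrite /= in_itv/= t0 /= ltNge rt.
Qed.

End Simplex.

(** * Unconditional bodies and factorization *)

(** The second-order error bound that replaces the derivative of ln in the
    first-order condition. *)
Lemma ln1D_lower (R : realType) (v : R) : - (1 / 2) <= v ->
  v - 2 * v ^+ 2 <= ln (1 + v).
Proof.
move=> v2; have v0 : 0 < 1 + v by lra.
have : ln (1 + - v / (1 + v)) <= - v / (1 + v).
  by apply: le_ln1Dx; rewrite ltr_pdivlMr//; lra.
rewrite (_ : 1 + - v / (1 + v) = (1 + v)^-1); last by field; rewrite gt_eqF.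
rewrite lnV ?posrE// mulNr lerNl opprK; apply: le_trans.
rewrite ler_pdivlMr//; nra.
Qed.

Lemma coord_le_norm (R : realType) n (x : 'rV[R]_n) i : `|x 0 i| <= `|x|.
Proof.
rewrite [leRHS]/Num.norm /= mx_normrE; apply/bigmax_geP; right => /=.
by exists (0, i).
Qed.

Section UnconditionalBody.
Context {R : realType} {n : nat}.
Implicit Types (x y z p : 'rV[R]_n) (K : set 'rV[R]_n).

Definition signed (eps : 'I_n -> R) x : 'rV[R]_n := \row_i (eps i * x 0 i).

Record unconditional_body K : Prop := {
  body_convex : forall x y (t : R), 0 <= t <= 1 -> K x -> K y ->
    K (t *: x + (1 - t) *: y) ;
  body_signed : forall (eps : 'I_n -> R) x,
    (forall i, eps i = -1 \/ eps i = 1) -> K x -> K (signed eps x) ;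
  body_closed : closed K ;
  body_bounded : bounded_set K ;
  body_interior : exists2 d : R, 0 < d & forall x, (forall i, `|x 0 i| <= d) -> K x
}.

Section Body.
Variable K : set 'rV[R]_n.
Hypothesis bK : unconditional_body K.

(** Decreasing one coordinate in absolute value is averaging a point with its
    reflection; the coordinates are treated one after the other. *)
Lemma body_solid x q : K q -> (forall i, `|x 0 i| <= `|q 0 i|) -> K x.
Proof.
move=> Kq xq.
suff gen (s : seq 'I_n) : forall x, (forall i, `|x 0 i| <= `|q 0 i|) ->
    (forall i, i \notin s -> x 0 i = q 0 i) -> K x.
  by apply: (gen (enum 'I_n)) => // i; rewrite mem_enum.
elim: s => [|i s IH] {xq}x xq xs.
  by rewrite (_ : x = q)//; apply/rowP => i; exact: xs.
pose y : 'rV[R]_n := \row_j (if j == i then q 0 j else x 0 j).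
have Ky : K y.
  apply: IH => j; rewrite mxE; first by case: ifP.
  by case: eqP => // /eqP ji js; apply: xs; rewrite in_cons negb_or ji.
(* x is on the segment joining y to its reflection in the i-th coordinate. *)
pose eps (j : 'I_n) : R := if j == i then -1 else 1.
have Kz : K (signed eps y).
  by apply: (body_signed bK) => // j; rewrite /eps; case: ifP; [left|right].
have [qi0|qi0] := eqVneq (q 0 i) 0.
  rewrite (_ : x = y)//; apply/rowP => j; rewrite mxE; case: eqP => // ->.
  by move: (xq i); rewrite qi0 normr0 normr_le0 => /eqP.
pose th := x 0 i / q 0 i.
have : `|th| <= 1 by rewrite normrM normfV ler_pdivrMr ?normr_gt0// mul1r.
rewrite ler_norml => /andP[th1 th2].
rewrite (_ : x = ((1 + th) / 2) *: y + (1 - (1 + th) / 2) *: signed eps y).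
  by apply: (body_convex bK) => //; lra.
apply/rowP => j; rewrite !mxE /eps; case: eqP => [->|_].
  by rewrite /th; field.
by field.
Qed.

Lemma polar_solid y (r : 'rV[R]_n) : polar K y -> (forall i, `|r 0 i| <= `|y 0 i|) -> polar K r.
Proof.
move=> py ry z Kz.
(* The signs of y make the pairing with w equal to the pairing of absolute values. *)
pose w : 'rV[R]_n := \row_i (Num.sg (y 0 i) * `|z 0 i|).
have Kw : K w.
  apply: (body_solid Kz) => i; rewrite mxE normrM normr_id normr_sg.
  by case: (y 0 i != 0); rewrite ?mul1r ?mul0r.
apply: le_trans (py _ Kw); rewrite /dotv; apply: ler_sum => i _.
rewrite mxE (le_trans (ler_norm _))// normrM mulrC mulrAC -normrEsg.
by rewrite ler_wpM2r.
Qed.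

(** Lozanovskii's factorization.  The point c maximizes f x = sum p_i ln x_i over
    the positive points of K.  For z >= 0 in K, moving from c towards z does not
    increase f, which to first order says that sum p_i (z_i - c_i) / c_i <= 0;
    thus y with y_i = p_i / c_i satisfies <z, y> <= sum p_i <= 1, and solidity
    of K extends this to all z in K. *)
Lemma factorization p : (forall i, 0 < p 0 i) -> \sum_i p 0 i <= 1 ->
  exists x y, [/\ K x, polar K y & forall i, [/\ 0 < x 0 i, 0 < y 0 i &
    p 0 i = x 0 i * y 0 i]].
Proof.
move=> p0 p1.
have [d d0 dK] := body_interior bK.
have [M M1 KM] : exists2 M, 1 <= M /\ d <= M & forall x, K x -> forall i, `|x 0 i| <= M.
  have [M [_ KM]] := body_bounded bK.
  exists (Num.max (Num.max 1 d) (M + 1)).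
    by rewrite !le_max !lexx !orbT.
  move=> x Kx i; rewrite (le_trans (coord_le_norm x i))//.
  rewrite le_max; apply/orP; right; apply: KM => //; by rewrite ltrDl.
pose f x : R := \sum_i p 0 i * ln (x 0 i).
pose x0 : 'rV[R]_n := const_mx d.
have Kx0 : K x0 by apply: dK => i; rewrite mxE gtr0_norm.
have x0p i : 0 < x0 0 i by rewrite mxE.
pose P := \sum_i p 0 i * (ln M - ln d).
have lnMd : 0 <= ln M - ln d.
  by rewrite subr_ge0 ler_ln ?posrE// ?M1.2// (lt_le_trans d0)// M1.2.
(* exp (- L) is so small that a point of K with one coordinate below it has a
   smaller f than the constant point x0; the maximum of f is thus attained at
   a distance from the coordinate hyperplanes. *)
pose L := \sum_i P / p 0 i + 1 - ln M.
pose eta := expR (- L).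
have low i x : K x -> (forall j, 0 < x 0 j) -> x 0 i <= eta -> f x < f x0.
  move=> Kx xp xi.
  have M0 : 0 < M by rewrite (lt_le_trans ltr01)// M1.1.
  have f1 : f x <= p 0 i * - L + \sum_(j | j != i) p 0 j * ln M.
    rewrite /f (bigD1 i)//=; apply: lerD.
      by rewrite ler_pM2l// -ler_expR lnK ?posrE.
    apply: ler_sum => j _; rewrite ler_pM2l// ler_ln ?posrE//.
    by rewrite -(gtr0_norm (xp j)) KM.
  have -> : f x0 = \sum_j p 0 j * ln M - P.
    by rewrite /P -sumrB; apply: eq_bigr => j _; rewrite mxE; ring.
  apply: le_lt_trans f1 _.
  rewrite [in X in _ < X](bigD1 i)//= addrAC ltrD2r.
  suff : P < p 0 i * (L + ln M) by lra.
  rewrite /L subrK (bigD1 i)//= !mulrDr mulrC divfK ?gt_eqF// mulr1 -addrA.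
  rewrite ltrDl ltr_wpDl// mulr_ge0 ?(ltW (p0 i))//.
  apply: sumr_ge0 => j _; rewrite divr_ge0 ?(ltW (p0 j))//.
  by apply: sumr_ge0 => k _; rewrite mulr_ge0// ltW.
pose C : set 'rV[R]_n := K `&` [set x | forall i, eta <= x 0 i].
have Cx0 : C x0.
  split=> // i; rewrite leNgt; apply/negP => /ltW h.
  by have := low i x0 Kx0 x0p h; rewrite ltxx.
have cC : compact C.
  apply: bounded_closed_compact.
    have [N [Nr KN]] := body_bounded bK; exists N; split=> // r Nr' y [Ky _].
    exact: KN.
  apply: closedI; first exact: (body_closed bK).
  have -> : (fun x : 'rV[R]_n => forall i, eta <= x 0 i) =
      \bigcap_(i in [set: 'I_n]) [set x : 'rV[R]_n | eta <= x 0 i].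
    by apply/seteqP; split=> x h i; [move=> _; exact: h|exact: h].
  apply: closed_bigI => i _.
  apply: (@preimage_closed _ _ (fun x : 'rV[R]_n => x 0 i) [set t | eta <= t]).
    by move=> x _; exact: coord_continuous.
  exact: closed_ge.
have [||c] := @EVT_max_rV R n f C _ cC.
- by exists x0.
- apply: continuous_in_subspaceT => x; rewrite inE => -[_ xe].
  apply: sum_continuous_at => i.
  apply: (@continuousM _ _ (fun=> p 0 i) (fun x : 'rV[R]_n => ln (x 0 i))).
    by move=> y; exact: cst_continuous.
  have cx : {for x, continuous (fun x : 'rV[R]_n => x 0 i)}.
    exact: coord_continuous.
  have cl : {for x 0 i, continuous (@ln R)}.
    by apply: continuous_ln; rewrite (lt_le_trans _ (xe i))// expR_gt0.
  exact: (continuous_comp cx cl).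
rewrite inE => -[Kc ce] cmax.
have c0 i : 0 < c 0 i by rewrite (lt_le_trans _ (ce i))// expR_gt0.
have fmax x : K x -> (forall j, 0 < x 0 j) -> f x <= f c.
  move=> Kx x_gt0; have [h|h] := pselect (forall i, eta <= x 0 i).
    by apply: cmax; rewrite inE.
  have [i hi] : exists i, ~ eta <= x 0 i by apply/existsNP.
  rewrite (le_trans (ltW (low i x Kx x_gt0 _)))//; last first.
    by apply: cmax; rewrite inE.
  by apply/ltW; rewrite ltNge; apply/negP.
exists c, (\row_i (p 0 i / c 0 i)); split=> //; last first.
  move=> i; rewrite mxE; split=> //; first by rewrite divr_gt0.
  by rewrite mulrC divfK// gt_eqF.
suff main z : K z -> (forall i, 0 <= z 0 i) -> \sum_i z 0 i * (p 0 i / c 0 i) <= 1.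
  move=> z Kz; pose az : 'rV[R]_n := \row_i `|z 0 i|.
  have Kaz : K az by apply: (body_solid Kz) => i; rewrite mxE normr_id.
  have := main az Kaz; rewrite /dotv => H.
  apply: le_trans (H _); last by move=> i; rewrite mxE.
  apply: ler_sum => i _; rewrite !mxE ler_wpM2r ?ler_norm//.
  by rewrite divr_ge0// ltW.
move=> Kz z0; apply: le_trans p1.
rewrite -subr_le0 -sumrB.
pose S := \sum_i (p 0 i * ((z 0 i - c 0 i) / c 0 i)).
rewrite (_ : \sum_i _ = S); last first.
  by apply: eq_bigr => i _; field; rewrite gt_eqF.
(* S is the first-order term, and B bounds the second-order one. *)
pose B := \sum_i (p 0 i * (2 * ((z 0 i - c 0 i) / c 0 i) ^+ 2)).
have B0 : 0 <= B.
  by apply: sumr_ge0 => i _; rewrite mulr_ge0 ?(ltW (p0 i))// mulr_ge0// sqr_ge0.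
have SB t : 0 < t <= 1 / 2 -> S <= t * B.
  move=> /andP[t0 t2].
  pose w := t *: z + (1 - t) *: c.
  have Kw : K w by apply: (body_convex bK) => //; lra.
  have wE i : w 0 i = c 0 i * (1 + t * ((z 0 i - c 0 i) / c 0 i)).
    by rewrite !mxE; field; rewrite gt_eqF.
  have u1 i : -1 <= (z 0 i - c 0 i) / c 0 i.
    by rewrite ler_pdivlMr// mulN1r lerBrDr addrC subrr.
  have v2 i : - (1 / 2) <= t * ((z 0 i - c 0 i) / c 0 i).
    by have := u1 i; nra.
  have v0 i : 0 < 1 + t * ((z 0 i - c 0 i) / c 0 i) by have := v2 i; lra.
  have := fmax w Kw; rewrite -subr_le0 -sumrB => /(_ _).
  have wp j : 0 < w 0 j by rewrite wE mulr_gt0.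
  move=> /(_ wp) H.
  rewrite -subr_le0 -(pmulr_rle0 _ t0) /S /B mulr_sumr -sumrB mulr_sumr.
  apply: le_trans H; apply: ler_sum => i _.
  rewrite wE lnM ?posrE// [leRHS](_ : _ =
    p 0 i * ln (1 + t * ((z 0 i - c 0 i) / c 0 i))); last by ring.
  have h := ln1D_lower (v2 i); rewrite -(ler_pM2l (p0 i)) in h.
  apply: le_trans _ h; rewrite le_eqVlt; apply/orP; left; apply/eqP; ring.
rewrite leNgt; apply/negP => S0.
have SB0 : 0 < S + B by rewrite ltr_wpDr.
have t12 : 0 < S / (2 * (S + B)) <= 1 / 2.
  rewrite divr_gt0 ?mulr_gt0//= ler_pdivrMr ?mulr_gt0//; lra.
have := SB _ t12; rewrite mulrAC ler_pdivlMr ?mulr_gt0//; nra.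
Qed.

Let ratrow (q : 'rV[rat]_n) : 'rV[R]_n := \row_i ratr (q 0 i).

(** The rational points of K and of its polar span solid sets whose products cover
    the open simplex: p is dilated by kap > 1 before it is factorized, which
    leaves room to decrease both factors to rational points. *)
Lemma body_volume_product : exists U V : set 'rV[R]_n,
  [/\ rmeas U, rmeas V, U `<=` K, V `<=` polar K &
    ((4 ^+ n / n`!%:R)%:E <= rvol U * rvol V)%E].
Proof.
pose Q1 := [set q | K (ratrow q)]; pose Q2 := [set q | polar K (ratrow q)].
exists (hull Q1), (hull Q2); split; try exact: rmeas_hull.
- move=> x [q [Kq xq]]; apply: (body_solid Kq) => i; rewrite mxE.
  exact: le_trans (ltW (xq i)) (ler_norm _).
- move=> x [q [Kq xq]]; apply: (polar_solid Kq) => i; rewrite mxE.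
  exact: le_trans (ltW (xq i)) (ler_norm _).
apply: le_trans (hull_product Q1 Q2).
have := @rvol_simplex R n 1 ltr01; rewrite expr1n div1r => sv.
rewrite EFinM -sv; apply: lee_wpmul2l; first by rewrite lee_fin exprn_ge0.
apply: le_rvol => p [p0 p1].
have s0 : 0 <= \sum_i p 0 i by apply: sumr_ge0 => i _; exact/ltW/p0.
(* kap > 1, while kap times the sum of the p_i is still at most 1. *)
pose kap := 2 / (1 + \sum_i p 0 i).
have kap1 : 1 < kap by rewrite ltr_pdivlMr; lra.
have kap0 : 0 < kap by exact: lt_trans kap1.
have [||x [y [Kx py xy]]] := @factorization (kap *: p).
- by move=> i; rewrite mxE mulr_gt0.
- under eq_bigr do rewrite mxE.
  by rewrite -mulr_sumr /kap mulrAC ler_pdivrMr; lra.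
pose th := Num.sqrt kap^-1.
have th0 : 0 < th by rewrite sqrtr_gt0 invr_gt0.
have th2 : th * th = kap^-1 by rewrite -expr2 sqr_sqrtr// invr_ge0 ltW.
have th1 : th < 1.
  by rewrite -(ltr_pXn2r (_ : 0 < 2)%N) ?nnegrE ?(ltW th0)// expr1n expr2 th2 invf_lt1.
have approx (u : 'rV[R]_n) : (forall i, 0 < u 0 i) ->
    exists q : 'rV[rat]_n, forall i, th * u 0 i < ratr (q 0 i) < u 0 i.
  move=> u0; have ex i : exists q : rat, th * u 0 i < ratr q < u 0 i.
    have [|q] := @rat_in_itvoo R (th * u 0 i) (u 0 i); first by rewrite gtr_pMl.
    by rewrite in_itv/= => h; exists q.
  exists (\row_i projT1 (cid (ex i))) => i; rewrite mxE.
  by case: cid.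
have [q qx] : exists q : 'rV[rat]_n, forall i, th * x 0 i < ratr (q 0 i) < x 0 i.
  by apply: approx => i; have [] := xy i.
have [r ry] : exists q : 'rV[rat]_n, forall i, th * y 0 i < ratr (q 0 i) < y 0 i.
  by apply: approx => i; have [] := xy i.
have q0 i : 0 < ratr (q 0 i) :> R.
  by have [x0 _ _] := xy i; have /andP[h _] := qx i; rewrite (lt_trans _ h)// mulr_gt0.
have r0 i : 0 < ratr (r 0 i) :> R.
  by have [_ y0 _] := xy i; have /andP[h _] := ry i; rewrite (lt_trans _ h)// mulr_gt0.
exists (q, r) => /=; split; first split.
- apply: (body_solid Kx) => i; rewrite mxE gtr0_norm//.
  have /andP[_ h] := qx i; exact: le_trans (ltW h) (ler_norm _).
- apply: (polar_solid py) => i; rewrite mxE gtr0_norm//.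
  have /andP[_ h] := ry i; exact: le_trans (ltW h) (ler_norm _).
- move=> i; split=> //; have [x0 y0] := xy i; rewrite mxE => pE.
  have -> : p 0 i = (th * x 0 i) * (th * y 0 i).
    by rewrite mulrACA th2 -pE mulKf// gt_eqF.
  have /andP[hq _] := qx i; have /andP[hr _] := ry i.
  by apply: ltr_pM; rewrite ?mulr_ge0 ?(ltW th0)// ltW.
Qed.

End Body.
End UnconditionalBody.

(** * Unconditional coordinates *)

Section Coordinates.
Context {R : realType} {n : nat}.
Variable A : set 'rV[R]_n.
Hypothesis A_domain : domain A.
Hypothesis A_convex : convex_set A.
Hypothesis A_bounded : bounded_set A.
Hypothesis A_sym : centrally_symmetric A.

Lemma domain_convex_comb x y (t : R) : 0 <= t <= 1 -> A x -> A y ->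
  A (t *: x + (1 - t) *: y).
Proof.
move=> /andP[t0 t1] Ax Ay.
have := A_convex (Itv01 t0 t1) (mem_set Ax) (mem_set Ay).
by rewrite inE.
Qed.

Lemma domain_closed : closed A.
Proof. by have [U [_ _ ->]] := A_domain; exact: closed_closure. Qed.

(** A ball around u is averaged with the point -u. *)
Lemma domain_contains_ball : exists2 e : R, 0 < e & forall v : 'rV[R]_n, `|v| < e -> A v.
Proof.
have [U [oU [u Uu] AU]] := A_domain.
have UA : U `<=` A by rewrite AU; exact: subset_closure.
have /nbhs_ballP[e /= e0 eU] : nbhs u U by exact: open_nbhs_nbhs.
exists (e / 2); first by rewrite divr_gt0.
move=> v ve.
have Auv : A (u + 2 *: v).
  apply/UA/eU; rewrite -ball_normE /= opprD addrA subrr sub0r normrN normrZ.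
  by rewrite gtr0_norm// mulrC -ltr_pdivlMr.
have := @domain_convex_comb (u + 2 *: v) (- u) (1 / 2) _ Auv (A_sym (UA _ Uu)).
have -> : 1 / 2 *: (u + 2 *: v) + (1 - 1 / 2) *: - u = v.
  by apply/rowP => i; rewrite !mxE; field.
by apply; lra.
Qed.

Lemma domain_contains0 : A 0.
Proof. by have [e e0 h] := domain_contains_ball; apply: h; rewrite normr0. Qed.

Lemma domain_shrink x (t : R) : 0 <= t <= 1 -> A x -> A (t *: x).
Proof.
by move=> t01 Ax; have := domain_convex_comb t01 Ax domain_contains0; rewrite scaler0 addr0.
Qed.

Let gauge_set x := [set t : R | 0 <= t /\ [set t *: y | y in A] x].

Let gauge_lb x : has_lbound (gauge_set x).
Proof. by exists 0 => t []. Qed.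

Lemma norm_of_le1 x : A x -> norm_of A x <= 1.
Proof.
move=> Ax; apply: (ge_inf (gauge_lb x)); split=> //; exists x => //.
by rewrite scale1r.
Qed.

(** If the norm is at most 1, then l x is in A for each l in (0, 1), and A is
    closed. *)
Lemma norm_of_le1_mem x : norm_of A x <= 1 -> A x.
Proof.
move=> x1; have [e e0 eA] := domain_contains_ball.
have ne : gauge_set x !=set0.
  pose t := (`|x| + 1) * 2 / e; have t0 : 0 < t.
    by rewrite divr_gt0// mulr_gt0// ltr_wpDl.
  exists t; split; first exact: ltW.
  exists (t^-1 *: x); last by rewrite scalerA mulfV ?scale1r// gt_eqF.
  apply: eA; rewrite normrZ gtr0_norm ?invr_gt0// mulrC ltr_pdivrMr//.
  by rewrite /t mulrCA mulfV ?mulr1 ?gt_eqF//; have := normr_ge0 x; lra.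
have small l : 0 < l < 1 -> A (l *: x).
  move=> /andP[l0 l1]; have : norm_of A x < l^-1.
    by rewrite (le_lt_trans x1)// invf_gt1.
  move=> /(inf_lt ne)[t [t0 [y Ay <-]] tl].
  rewrite scalerA; apply: domain_shrink Ay; rewrite mulr_ge0 ?(ltW l0)//=.
  by rewrite mulrC -ler_pdivlMr// div1r ltW.
have cx : l *: x @[l --> 1^'-] --> x.
  apply: cvg_at_left_filter; rewrite -[X in _ --> X]scale1r.
  exact: scalel_continuous.
apply: (closed_cvg _ domain_closed _ _ cx); near=> l; apply: small.
apply/andP; split; near: l; [exact: nbhs_left_gt|exact: nbhs_left_lt].
Unshelve. all: by end_near. Qed.

End Coordinates.

Lemma norm_le_coord (R : realType) n (x : 'rV[R]_n) M : 0 <= M ->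
  (forall i, `|x 0 i| <= M) -> `|x| <= M.
Proof.
move=> M0 h; rewrite /Num.norm /= mx_normrE; apply/bigmax_leP; split=> //.
by move=> [i j] _ /=; rewrite ord1; exact: h.
Qed.

(** The norm determined by A determines A, as A is closed; hence invariance of the norm under
    sign changes is invariance of the body. *)
Lemma unconditional_coordinates (R : realType) n (A : set 'rV[R]_n) :
  domain A -> convex_set A -> bounded_set A -> one_unconditional A ->
  exists M : 'M[R]_n, M \in unitmx /\ unconditional_body [set a | A (a *m M)].
Proof.
move=> A_domain A_convex A_bounded [A_sym [eta eta_basis A_unc]].
pose M : 'M[R]_n := \matrix_(i, j) tnth eta i 0 j.
have ME a : a *m M = \sum_i a 0 i *: tnth eta i.
  rewrite mulmx_sum_row; apply: eq_bigr => i _; congr (_ *: _).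
  by apply/rowP => j; rewrite !mxE.
have uM : M \in unitmx.
  rewrite unitmxE unitfE; apply/negP => /det0P[v v0 vM].
  have /andP[_ /freeP fr] := eta_basis.
  move/eqP: v0; apply; apply/rowP => i; rewrite mxE.
  have h : \sum_(i < n) v 0 i *: eta`_i = 0.
    by rewrite -[RHS]vM ME; apply: eq_bigr => j _; rewrite (tnth_nth 0).
  exact: (fr (fun i => v 0 i) h i).
exists M; split=> //; split.
- move=> x y t t01 Kx Ky /=; rewrite mulmxDl -!scalemxAl.
  exact: domain_convex_comb.
- move=> eps x heps Kx /=; apply: (norm_of_le1_mem A_domain A_convex A_sym).
  have := A_unc (fun i => x 0 i) eps heps; rewrite -ME => E.
  rewrite ME; under eq_bigr do rewrite mxE.
  by rewrite -E; apply: norm_of_le1.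
- apply: (@preimage_closed _ _ (fun a : 'rV[R]_n => a *m M) A); last exact: domain_closed.
  by move=> x _; exact: mulmxr_continuous.
- have [N [Nr AN]] := A_bounded.
  pose N' := Num.max N 0 + 1; have AN' y : A y -> `|y| <= N'.
    by apply: AN; rewrite /N' ltr_pwDr// le_max lexx.
  have N0 : 0 <= N' by rewrite addr_ge0// le_max lexx orbT.
  pose B := \sum_i \sum_j N' * `|invmx M j i|.
  exists B; split; first exact: num_real.
  move=> r Br a Ka; apply: le_trans (ltW Br).
  have s0 i j : 0 <= N' * `|invmx M j i| by rewrite mulr_ge0.
  apply: norm_le_coord => [|i].
    by apply: sumr_ge0 => i _; apply: sumr_ge0.
  rewrite -[a](mulmxK uM) mxE (le_trans (ler_norm_sum _ _ _))//.
  rewrite /B [leRHS](bigD1 i)//= ler_wpDr ?sumr_ge0// => [k _|]; first exact: sumr_ge0.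
  apply: ler_sum => j _; rewrite normrM ler_wpM2r//.
  exact: le_trans (coord_le_norm _ _) (AN' _ Ka).
- have [e e0 eA] := domain_contains_ball A_domain A_convex A_sym.
  have c0 := @mulmxr_continuous R n M 0.
  have : \forall a \near (0 : 'rV[R]_n), `|a *m M| < e.
    have : a *m M @[a --> (0 : 'rV[R]_n)] --> (0 : 'rV[R]_n).
      by rewrite -[X in _ --> X](mul0mx _ M); exact: c0.
    by move=> /cvgr0Pnorm_lt/(_ e e0).
  move=> /nbhs_normP[d /= d0 dA]; exists (d / 2); first by rewrite divr_gt0.
  move=> a ad; apply: eA; apply: dA; rewrite /= sub0r normrN.
  rewrite (@le_lt_trans _ _ (d / 2))//; last by lra.
  by apply: norm_le_coord => //; rewrite ltW// divr_gt0.
Qed.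

(** * The two inequalities *)

Lemma dotvE (R : realType) n (x y : 'rV[R]_n) : dotv x y = (x *m y^T) 0 0.
Proof. by rewrite mxE; apply: eq_bigr => i _; rewrite mxE. Qed.

Lemma polar_linear (R : realType) n (A : set 'rV[R]_n) (M : 'M[R]_n) y :
  M \in unitmx -> polar [set a | A (a *m M)] (y *m M^T) <-> polar A y.
Proof.
move=> uM; split=> py x Ax.
  have := py (x *m invmx M); rewrite /= mulmxKV// => /(_ Ax).
  by rewrite !dotvE trmx_mul trmxK mulmxA mulmxKV.
by rewrite dotvE trmx_mul trmxK mulmxA -dotvE; exact: py.
Qed.

Section Capacity.
Context {R : realType} {n : nat}.
Variable K : set 'rV[R]_n.
Hypothesis bK : unconditional_body K.

(** For x in K the point x_1 e_1 is in K by solidity, hence |x_1| |y_1| <= 1 for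
    every y in the polar. *)
Lemma body_slab (i0 : 'I_n) : exists2 a : R, 0 < a &
  forall x y, K x -> polar K y -> `|x 0 i0| <= a /\ `|y 0 i0| <= a^-1.
Proof.
pose S := [set t : R | exists2 x, K x & t = `|x 0 i0|].
have [d d0 dK] := body_interior bK.
have Sub : has_ubound S.
  have [N [_ KN]] := body_bounded bK; exists (N + 1) => _ [x Kx ->].
  by rewrite (le_trans (coord_le_norm _ _))// (KN (N + 1)) ?ltrDl.
have Sd : S d.
  exists (const_mx d) => [|]; last by rewrite mxE gtr0_norm.
  by apply: dK => i; rewrite mxE gtr0_norm.
have a0 : 0 < sup S by rewrite (lt_le_trans d0)// (ub_le_sup Sub).
exists (sup S) => // x y Kx py; split.
  by apply: (ub_le_sup Sub); exists x.
have [y0|y0] := eqVneq `|y 0 i0| 0; first by rewrite y0 invr_ge0 ltW.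
have y_gt0 : 0 < `|y 0 i0| by rewrite lt_neqAle eq_sym y0 normr_ge0.
rewrite -[leLHS]invrK lef_pV2 ?posrE ?invr_gt0//.
apply: ge_sup; first by exists d.
move=> _ [z Kz ->]; rewrite -div1r ler_pdivlMr//.
pose w : 'rV[R]_n := \row_i (if i == i0 then Num.sg (y 0 i0) * `|z 0 i0| else 0).
have Kw : K w.
  apply: (body_solid bK Kz) => i; rewrite mxE; case: eqP => [->|_]; last by rewrite normr0.
  by rewrite normrM normr_id normr_sg; case: (_ != 0); rewrite ?mul1r ?mul0r.
have := py w Kw; rewrite /dotv (bigD1 i0)//= big1 => [|i /negPf ii0].
  by rewrite addr0 mxE eqxx mulrAC -normrEsg mulrC.
by rewrite mxE ii0 mul0r.
Qed.

End Capacity.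

Lemma capacity_le4 (R : realType) (n : nat) (n_gt0 : (0 < n)%N)
    (A : set 'rV[R]_n) (M : 'M[R]_n) (c : set (Rxy R n) -> \bar R) :
  M \in unitmx -> unconditional_body [set a | A (a *m M)] ->
  symplectic_capacity c -> normalized c ->
  (c (lagrangian_product A (polar A)) <= 4%:E)%E.
Proof.
move=> uM bK cP cN; pose i0 := Ordinal n_gt0.
have [a a0 slab] := body_slab bK i0.
have uMT : M^T \in unitmx by rewrite unitmx_tr.
have uMi : invmx M \in unitmx by rewrite unitmx_inv.
have sD := dualmap_diffeo uMi uMT.
have sC : conformally_symplectic 1 (dualmap (invmx M) M^T).
  by apply: dualmap_conformal; rewrite trmxK mulVmx.
have := capacity_conformal cP sD (oner_neq0 _) sC (lagrangian_product A (polar A)).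
rewrite normr1 mul1e => <-.
apply: le_trans (capacity_rectangle cP cN (erefl : i0 = 0%N :> nat) a0).
apply: (capacity_monotone cP) => _ [[x y] [/= Ax py] <-] /=.
by apply: slab; [rewrite /= mulmxKV|apply/polar_linear].
Qed.

(** The determinants of M^-1 and of M^T cancel in the product of the two volumes. *)
Lemma volume_ge (R : realType) (n : nat) (A : set 'rV[R]_n) (M : 'M[R]_n) :
  M \in unitmx -> unconditional_body [set a | A (a *m M)] ->
  ((4 ^+ n / n`!%:R)%:E <= volume (lagrangian_product A (polar A)))%E.
Proof.
move=> uM bK; have [U [V [mU mV UK VK UV]]] := body_volume_product bK.
apply: le_trans UV _.
have uMT : M^T \in unitmx by rewrite unitmx_tr.
have uMi : invmx M \in unitmx by rewrite unitmx_inv.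
pose U' := [set x | U (x *m invmx M + 0)]; pose V' := [set y | V (y *m M^T + 0)].
have mU' : rmeas U' := rmeas_affine _ _ mU.
have mV' : rmeas V' := rmeas_affine _ _ mV.
have -> : (rvol U * rvol V = rvol U' * rvol V')%E.
  rewrite (affine_scaling_unit uMi 0 mU) (affine_scaling_unit uMT 0 mV).
  rewrite muleACA -EFinM det_inv det_tr normfV invrK mulfV ?mul1e//.
  by rewrite normr_eq0 -unitfE -unitmxE.
pose mu := @lebesgue_tuple R n.
rewrite -[leLHS](@product_measure1E _ _ _ _ _ mu mu)//.
apply: le_integral_any => p /=; first exact: measure_ge0.
rewrite -[leLHS]/(mu _) -[leRHS]/(mu _).
pose S1 := [set y : 'rV[R]_n | U' (rowt p) /\ V' y].
pose S2 := [set y : 'rV[R]_n | A (rowt p) /\ polar A y].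
have -> : xsection ((@rowt R n @^-1` U') `*` (@rowt R n @^-1` V')) p =
   @rowt R n @^-1` S1.
  by apply/seteqP; split=> q; rewrite /xsection /= inE.
have -> : xsection [set p0 | lagrangian_product A (polar A)
     (\row_i tnth p0.1 i, \row_i tnth p0.2 i)] p = @rowt R n @^-1` S2.
  by apply/seteqP; split=> q; rewrite /xsection /= inE.
apply: le_rvol => y []; rewrite /U' /V' /S2 /= !addr0 => /UK /= + /VK /polar_linear pA.
by rewrite mulmxKV// => Ap; split=> //; exact: pA.
Qed.

Theorem theorem1p8 (R : realType) (n : nat) (n_gt0 : (0 < n)%N)
    (A : set 'rV[R]_n)
    (A_domain : domain A) (A_convex : convex_set A) (A_bounded : bounded_set A)
    (A_unconditional : one_unconditional A)
    (c : set (Rxy R n) -> \bar R)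
    (c_capacity : symplectic_capacity c) (c_normalized : normalized c) :
  (c (lagrangian_product A (polar A)) <= 4%:E <=
   (n`!%:R%:E * volume (lagrangian_product A (polar A))) `^ (n%:R^-1))%E.
Proof.
have [M [uM bK]] :=
  unconditional_coordinates A_domain A_convex A_bounded A_unconditional.
rewrite (capacity_le4 n_gt0 uM bK c_capacity c_normalized) /=.
have n0 : n%:R != 0 :> R by rewrite pnatr_eq0 -lt0n.
have -> : 4%:E = (((4 : R) ^+ n)%:E `^ (n%:R^-1))%E.
  by rewrite poweR_EFin -powR_mulrn// -powRrM mulfV// powRr1.
apply: gt0_ler_poweR; rewrite ?in_itv/= ?andbT ?leey ?invr_ge0//.
- by rewrite lee_fin exprn_ge0.
- rewrite andbT mule_ge0 ?lee_fin ?ler0n//; apply: le_trans _ (volume_ge uM bK).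
have f0 : 0 < n`!%:R :> R by rewrite ltr0n fact_gt0.
apply: le_trans (lee_wpmul2l _ (volume_ge uM bK)); last by rewrite lee_fin ltW.
by rewrite -EFinM mulrC divfK// gt_eqF.
Qed.
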